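(* Fix $\rho\in(0,1)$. Let $\boldsymbol\sigma\sim\mathbb P$, where $\mathbb P$ is the quadratic interaction model with coupling matrix $A_n$, field vector $c\in\mathbb R^n$ and base measures $\mu_1,\dots,\mu_n$. Let $m_i=\sum_{j=1}^nA_n(i,j)\sigma_j$ be the local fields and $s_i=\sum_{j=1}^nA_n(i,j)u_j$, where $u$ is the Mean-Field optimizer. (a) If $\|A_n\|\le\rho$, then $\mathbb E\sum_{i=1}^n(m_i-s_i)^2\lesssim n\alpha_n$. (b) If $\|A_n\|_4\le\rho$, then $\mathbb E\sum_{i=1}^n(m_i-s_i)^4\lesssim n\alpha_n^2$. (c) If $\|A_n\|_\infty\le\rho$, then for any $r\in[2,\infty)$, $$\mathbb E\sum_{i=1}^n|m_i-s_i|^r\lesssim n\Big(\frac{\alpha_n}{2ae(1-\rho)^2}\Big)^{\frac r2}r^{\frac{r+1}2},$$ where $a=a(\rho)>0$ is the concentration constant specified in the context. The implicit constants depend only on $\rho$; in (c) the implicit constant does not depend on $r$.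
   Context: Model: $\mu_1,\dots,\mu_n$ are non-degenerate probability measures supported on $[-1,1]$, with both $-1$ and $1$ in the support of each $\mu_i$; $A_n$ is a real symmetric $n\times n$ matrix with zero diagonal; $c\in\mathbb R^n$. The quadratic interaction model $\mathbb P$ is the probability measure on $[-1,1]^n$ with $$\frac{d\mathbb P}{d\prod_{i=1}^n\mu_i}(\boldsymbol\sigma)=\frac1{Z_n}\exp\Big(\tfrac12\boldsymbol\sigma^\top A_n\boldsymbol\sigma+c^\top\boldsymbol\sigma\Big).$$ $\|A_n\|$ is the $\ell_2$ operator norm and $\|A_n\|_r$ the $\ell_r\to\ell_r$ operator norm. $\alpha_n=\max_{1\le i\le n}\sum_{j=1}^nA_n(i,j)^2$. Mean-Field optimizer: $\psi_i(\theta)=\log\int e^{\theta z}\,d\mu_i(z)$, $\phi_i:(-1,1)\to\mathbb R$ is the inverse of $\psi_i':\mathbb R\to(-1,1)$, $I_i(z)=z\phi_i(z)-\psi_i(\phi_i(z))$ (extended to $\pm1$ by its limits in $[0,\infty]$). When $\|A_n\|<1$ (implied by any of $\|A_n\|,\|A_n\|_4,\|A_n\|_\infty\le\rho$), $F(z)=\frac12z^\top A_nz+z^\top c-\sum_iI_i(z_i)$ has a unique maximizer $u$ over $[-1,1]^n$; it lies in $(-1,1)^n$ and satisfies $u_i=\psi_i'(s_i+c_i)$. Constant $a$: $a=a(\rho)>0$ is a constant, depending only on $\rho$, such that for every $n$, every such model with $\|A_n\|\le\rho$, every $\gamma\in\mathbb R^n$ and every $t>0$, $\mathbb P\big(|\sum_i\gamma_i(\sigma_i-\mathbb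 E[\sigma_i\mid\sigma_j,j\ne i])|>t\big)\le2\exp(-at^2/\|\gamma\|^2)$ (such a constant exists). *)

(* Defs.v *)
From HB Require Import structures.
From mathcomp Require Import all_boot all_order all_algebra.
From mathcomp Require Import all_classical all_reals all_analysis.

Set Implicit Arguments.
Unset Strict Implicit.
Unset Printing Implicit Defensive.

Import Order.TTheory GRing.Theory Num.Theory.
Import numFieldNormedType.Exports.

Local Open Scope classical_set_scope.
Local Open Scope ring_scope.

(** * Finite products of probability measures *)

Definition tuple_cons d (T : measurableType d) n (p : T * n.-tuple T) :
  n.+1.-tuple T := [tuple of p.1 :: p.2].

Lemma measurable_tuple_cons d (T : measurableType d) n :
  measurable_fun [set: T * n.-tuple T] (@tuple_cons d T n).
Proof. by apply: measurable_cons. Qed.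

HB.instance Definition _ d (T : measurableType d) n :=
  isMeasurableFun.Build _ _ _ _ (@tuple_cons d T n)
    (@measurable_tuple_cons d T n).

Fixpoint prod_prob d (T : measurableType d) (R : realType) n :
    ('I_n -> probability T R) -> probability (n.-tuple T) R :=
  match n with
  | 0 => fun _ => @dirac _ (0.-tuple T) [tuple] R
  | n'.+1 => fun mu =>
      distribution (mu ord0 \x prod_prob (fun i => mu (lift ord0 i)))%E
        (@tuple_cons d T n')
  end.

Lemma prod_prob_box d (T : measurableType d) (R : realType) n
    (mu : 'I_n -> probability T R) (B : 'I_n -> set T) :
  (forall i, measurable (B i)) ->
  prod_prob mu [set x | forall i, B i (tnth x i)] =
  (\prod_(i < n) mu i (B i))%E.
Proof.
elim: n mu B => [|n IH] mu B mB /=.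
  by rewrite big_ord0 diracE mem_set// => -[].
rewrite big_ord_recl -IH //= /distribution /pushforward /=.
have mC : measurable [set x : n.-tuple T | forall i, B (lift ord0 i) (tnth x i)].
  rewrite [X in measurable X](_ : _ =
    \big[setI/setT]_(i < n) ((@tnth n T ^~ i) @^-1` B (lift ord0 i))).
    apply: bigsetI_measurable => i _.
    by rewrite -[X in measurable X]setTI; exact: measurable_tnth.
  rewrite -bigcap_seq; apply/seteqP; split=> [x h i _|x h i]; first exact: h.
  by apply: h => /=; rewrite mem_index_enum.
rewrite -product_measure1E //; congr (_ _).
apply/seteqP; split=> [[x y] /= h|[x y] /= [h0 h] i].
  by split=> [|i]; [have := h ord0|have := h (lift ord0 i); rewrite tnthS].
by case: (unliftP ord0 i) => [j|] ->//; rewrite tnthS.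
Qed.

(** * The quadratic interaction model *)

Section model.
Variable R : realType.

Definition msupport (mu : probability R R) : set R :=
  [set x | forall U : set R, open U -> U x -> (0 < mu U)%E].

Definition base_measure (mu : probability R R) : Prop :=
  [/\ mu `[-1, 1]%classic = 1%E, ~ (exists x, mu [set x] = 1%E),
      msupport mu (-1) & msupport mu 1].

Definition coupling_matrix n (A : 'M[R]_n) : Prop :=
  A^T = A /\ forall i, A i i = 0.

Definition spins n (x : n.-tuple R) : 'cV[R]_n := \col_i tnth x i.

Definition hamiltonian n (A : 'M[R]_n) (c v : 'cV[R]_n) : R :=
  2^-1 * (v^T *m A *m v) 0 0 + (c^T *m v) 0 0.

Definition partition_function n (mu : 'I_n -> probability R R)
    (A : 'M[R]_n) (c : 'cV[R]_n) : R :=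
  \int[prod_prob mu]_x expR (hamiltonian A c (spins x)).

(* [P] lives on R^n; it is carried by [-1, 1]^n since the base measures are
   carried by [-1, 1]. *)
Definition quadratic_model n (mu : 'I_n -> probability R R)
    (A : 'M[R]_n) (c : 'cV[R]_n) (P : probability (n.-tuple R) R) : Prop :=
  [/\ forall i, base_measure (mu i), coupling_matrix A &
      forall E, measurable E ->
        P E = (\int[prod_prob mu]_(x in E)
          (expR (hamiltonian A c (spins x)) / partition_function mu A c)%:E)%E].

Definition local_field n (A : 'M[R]_n) (v : 'cV[R]_n) (i : 'I_n) : R :=
  \sum_j A i j * v j 0.

Definition alpha n (A : 'M[R]_n) : R :=
  \big[Num.max/0]_i \sum_j A i j ^+ 2.

Definition lpnorm (p : R) n (v : 'cV[R]_n) : R :=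
  (\sum_i `|v i 0| `^ p) `^ p^-1.

Definition linfnorm n (v : 'cV[R]_n) : R := \big[Num.max/0]_i `|v i 0|.

Definition opnorm n (N : 'cV[R]_n -> R) (A : 'M[R]_n) : R :=
  sup [set N (A *m v) | v in [set v | N v <= 1]].

(** * The mean-field optimizer *)

Definition psi (mu : probability R R) (theta : R) : R :=
  ln (\int[mu]_z expR (theta * z)).

Definition phi (mu : probability R R) (z : R) : R :=
  xget 0 [set theta | derive1 (psi mu) theta = z].

Definition rate_in (mu : probability R R) (z : R) : R :=
  z * phi mu z - psi mu (phi mu z).

(* Only used for z in [-1, 1]. *)
Definition rate (mu : probability R R) (z : R) : \bar R :=
  if z == 1 then lim ((rate_in mu x)%:E @[x --> (1 : R)^'-])
  else if z == -1 then lim ((rate_in mu x)%:E @[x --> (-1 : R)^'+])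
  else (rate_in mu z)%:E.

Definition mean_field n (mu : 'I_n -> probability R R)
    (A : 'M[R]_n) (c v : 'cV[R]_n) : \bar R :=
  ((hamiltonian A c v)%:E - \sum_i rate (mu i) (v i 0)%R)%E.

Definition cube n : set 'cV[R]_n := [set v | forall i, -1 <= v i 0 <= 1].

Definition mean_field_optimizer n (mu : 'I_n -> probability R R)
    (A : 'M[R]_n) (c u : 'cV[R]_n) : Prop :=
  cube u /\ forall v, cube v -> (mean_field mu A c v <= mean_field mu A c u)%E.

(** * Conditional expectations and the concentration constant *)

(* [Y] is a version of the conditional expectation of [X] given the
   sub-sigma-algebra [G]. *)
Definition cond_expectation d (T : measurableType d) (P : probability T R)
    (X : T -> R) (G : set (set T)) (Y : T -> R) : Prop :=
  [/\ forall B, measurable B -> G (Y @^-1` B),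
      P.-integrable setT (EFin \o Y) &
      forall B, G B ->
        (\int[P]_(w in B) (Y w)%:E = \int[P]_(w in B) (X w)%:E)%E].

Definition sigma_others n (i : 'I_n) : set (set (n.-tuple R)) :=
  <<s \bigcup_(j in [set j | j != i])
        preimage_set_system setT (fun x : n.-tuple R => tnth x j) measurable >>.

Definition concentration_constant (rho a : R) : Prop :=
  0 < a /\
  forall (n : nat) (mu : 'I_n -> probability R R) (A : 'M[R]_n) (c : 'cV[R]_n)
    (P : probability (n.-tuple R) R),
  quadratic_model mu A c P -> opnorm (@lpnorm 2 n) A <= rho ->
  forall b : 'I_n -> n.-tuple R -> R,
  (forall i, cond_expectation P (fun x => tnth x i) (sigma_others i) (b i)) ->
  forall (gamma : 'cV[R]_n) (t : R), 0 < t ->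
  (P [set x | (t < `|\sum_i gamma i 0 * (tnth x i - b i x)|)%R] <=
     (2 * expR (- (a * t ^+ 2 / lpnorm 2 gamma ^+ 2)))%:E)%E.

End model.

(* Main.v *)
(*
Proof idea.  Write b_j = psi_j'(m_j + c_j) for the conditional mean of sigma_j
given the other spins, and w = m - s.  Since u_j = psi_j'(s_j + c_j) and psi_j'
is 1-Lipschitz, w = X + A D with X = A (sigma - b) and |D_j| <= |w_j|; as A
contracts by rho, the l_r norm of w is at most (1 - rho)^-1 times that of X
(for r >= 2 real and l_infinity, by Jensen with the weights |A_ij|).

It remains to bound moments of F = sum_j gamma_j (sigma_j - b_j), where gamma is
a row of A.  In E[F^(k+1)] = sum_i gamma_i E[F^k (sigma_i - b_i)] one may
subtract from F^k its value F_i^k after sigma_i is set to 0, which is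
independent of sigma_i.  A second-order Taylor expansion of psi_j' together with
|A| <= 1 gives sum_i (F - F_i)^2 <= 54 |gamma|^2, whence E F^2 and E F^4 are of
order |gamma|^2 and |gamma|^4.  This proves (a) and (b) without any concentration
inequality.  For (c) the concentration constant makes Y = a F^2 / alpha
subexponential; E Y^k <= 2 e k! for integers k, and interpolation between
integers together with Stirling's bound yields the factor r^((r+1)/2).
*)
From HB Require Import structures.
Require Import Defs.
From mathcomp Require Import all_boot all_order all_algebra.
From mathcomp Require Import all_classical all_reals all_analysis.
From mathcomp Require Import measurable_realfun ring lra.
Set Implicit Arguments.
Unset Strict Implicit.
Unset Printing Implicit Defensive.
Import Order.TTheory GRing.Theory Num.Theory.
Import numFieldNormedType.Exports.
Local Open Scope classical_set_scope.
Local Open Scope ring_scope.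

(** * Functions bounded on a set of full measure *)

(** The equation u_i = psi_i'(s_i + c_i) is not read off from a vanishing gradient: the optimizer is
    only known to lie in the closed cube, where the rate is a limit at the endpoints and may be
    infinite. It comes from the equality case of Fenchel's inequality, tested by changing one
    coordinate of u.

    Taylor's expansion to second order is essential for the sum of (F - F_i)^2. A Lipschitz bound on
    b_j would bring in the matrix of the |A_ij|, whose l_2 norm is not controlled by that of A. The
    linear term keeps the signs of A, so the contraction applies to it; the remainder involves only
    A_ij^2, whose row sums are at most 1.

    This l_2 contraction is used in (b) and (c) as well, where another norm is assumed. Since A is
    symmetric, the bound transfers with the same rho, by comparing growth rates of the iterates A^k.

    In (c) the constant may not depend on r, so no power of r can be lost: Stirling's bound is taken
    with its exact exponent k + 1/2, and the interpolation between k and k + 1 costs a bounded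
    factor. *)

Section bounded_on.
Context {d : measure_display} {T : measurableType d} {R : realType}.
Implicit Types (Q : set T) (f g : T -> R).

(** The laws live on R or R^n but are carried by a cube, so boundedness is asked on [Q] only and
    measurability everywhere. Closure under algebraic operations then settles the integrability side
    conditions. *)
Definition mbounded Q f :=
  measurable_fun setT f /\ exists M, forall x, Q x -> `|f x| <= M.

Lemma mbounded_cst Q (k : R) : mbounded Q (fun=> k).
Proof. by split; [exact: measurable_cst|exists `|k|]. Qed.

Lemma mboundedD Q f g : mbounded Q f -> mbounded Q g -> mbounded Q (fun x => f x + g x).
Proof.
move=> [mf [M Mf]] [mg [N Ng]]; split; first exact: measurable_funD.
by exists (M + N) => x Qx; rewrite (le_trans (ler_normD _ _))// lerD ?Mf ?Ng.
Qed.

Lemma mboundedM Q f g : mbounded Q f -> mbounded Q g -> mbounded Q (fun x => f x * g x).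
Proof.
move=> [mf [M Mf]] [mg [N Ng]]; split; first exact: measurable_funM.
by exists (M * N) => x Qx; rewrite normrM ler_pM// ?Mf ?Ng.
Qed.

Lemma mboundedZ Q f (k : R) : mbounded Q f -> mbounded Q (fun x => k * f x).
Proof. exact/mboundedM/mbounded_cst. Qed.

Lemma mboundedN Q f : mbounded Q f -> mbounded Q (fun x => - f x).
Proof.
by move=> [mf [M Mf]]; split; [exact: measurableT_comp|exists M => x Qx; rewrite normrN Mf].
Qed.

Lemma mboundedB Q f g : mbounded Q f -> mbounded Q g -> mbounded Q (fun x => f x - g x).
Proof. by move=> bf bg; apply: mboundedD => //; exact: mboundedN. Qed.

Lemma mboundedX Q f k : mbounded Q f -> mbounded Q (fun x => f x ^+ k).
Proof.
move=> bf; elim: k => [|k IH]; first exact: mbounded_cst.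
by rewrite [X in mbounded _ X](_ : _ = fun x => f x * f x ^+ k);
  [exact: mboundedM|apply/funext => x; rewrite exprS].
Qed.

Lemma mbounded_norm Q f : mbounded Q f -> mbounded Q (fun x => `|f x|).
Proof.
move=> [mf [M Mf]]; split; first exact: measurableT_comp.
by exists M => x Qx; rewrite normr_id Mf.
Qed.

Lemma mbounded_expR Q f : mbounded Q f -> mbounded Q (fun x => expR (f x)).
Proof.
move=> [mf [M Mf]]; split; first exact: measurableT_comp.
exists (expR M) => x Qx; rewrite ger0_norm ?expR_ge0// ler_expR.
by rewrite (le_trans (ler_norm _))// Mf.
Qed.

Lemma mbounded_sum Q (I : Type) (s : seq I) (F : I -> T -> R) :
  (forall i, mbounded Q (F i)) -> mbounded Q (fun x => \sum_(i <- s) F i x).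
Proof.
move=> bF; elim: s => [|i s IH].
  by rewrite [X in mbounded _ X](_ : _ = cst 0); [exact: mbounded_cst|apply/funext =>
    x; rewrite big_nil].
by rewrite [X in mbounded _ X](_ : _ = fun x => F i x + \sum_(i <- s) F i x);
  [exact: mboundedD|apply/funext => x; rewrite big_cons].
Qed.

Lemma mbounded_indic Q A : measurable A -> mbounded Q (\1_A).
Proof.
move=> mA; split; first exact: measurable_indic.
by exists 1 => x _; rewrite indicE; case: (_ \in _); rewrite ?normr1 ?normr0.
Qed.

Context (P : probability T R) (Q : set T).
Hypotheses (mQ : measurable Q) (PQ : P Q = 1%E).

Lemma full_setC : P (~` Q) = 0%E.
Proof. by rewrite probability_setC// [X in (_ - X)%E]PQ subee. Qed.

Lemma mbounded_integrable f : mbounded Q f -> P.-integrable setT (EFin \o f).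
Proof.
move=> [mf [M Mf]].
apply/(@negligible_integrable _ _ _ _ setT (~` Q)) => //.
- exact: measurableC.
- exact/measurable_EFinP.
- exact: full_setC.
rewrite setTD setCK; apply: measurable_bounded_integrable => //.
- by rewrite [X in (X < _)%E]PQ ltry.
- exact: measurable_funTS.
- exists M; split; first exact: num_real.
  by move=> N MN x Qx; exact: le_trans (Mf _ Qx) (ltW MN).
Qed.

Lemma mbounded_Rintegral f : mbounded Q f ->
  \int[P]_x f x = \int[P]_(x in Q) f x.
Proof.
move=> bf; rewrite /Rintegral.
rewrite (@negligible_integral _ _ _ _ setT (~` Q)) ?setTD ?setCK//.
- exact: measurableC.
- exact: mbounded_integrable.
- exact: full_setC.
Qed.

Lemma mbounded_le_Rintegral f g : mbounded Q f -> mbounded Q g ->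
  (forall x, Q x -> f x <= g x) -> \int[P]_x f x <= \int[P]_x g x.
Proof.
move=> bf bg fg; rewrite !mbounded_Rintegral//; apply: le_Rintegral => //.
- by apply: (@integrableS _ _ _ P setT) => //; exact: mbounded_integrable.
- by apply: (@integrableS _ _ _ P setT) => //; exact: mbounded_integrable.
Qed.

Lemma mbounded_RintegralD f g : mbounded Q f -> mbounded Q g ->
  \int[P]_x (f x + g x) = \int[P]_x f x + \int[P]_x g x.
Proof. by move=> bf bg; rewrite RintegralD//; exact: mbounded_integrable. Qed.

Lemma mbounded_RintegralB f g : mbounded Q f -> mbounded Q g ->
  \int[P]_x (f x - g x) = \int[P]_x f x - \int[P]_x g x.
Proof. by move=> bf bg; rewrite RintegralB//; exact: mbounded_integrable. Qed.

Lemma mbounded_RintegralZl f k : mbounded Q f ->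
  \int[P]_x (k * f x) = k * \int[P]_x f x.
Proof. by move=> bf; rewrite RintegralZl//; exact: mbounded_integrable. Qed.

Lemma Rintegral_cstT (k : R) : \int[P]_x k = k.
Proof. by rewrite Rintegral_cst// [X in fine X]probability_setT mulr1. Qed.

Lemma mbounded_Rintegral_sum (I : Type) (s : seq I) (F : I -> T -> R) :
  (forall i, mbounded Q (F i)) ->
  \int[P]_x (\sum_(i <- s) F i x) = \sum_(i <- s) \int[P]_x F i x.
Proof.
move=> bF; elim: s => [|i s IH].
  by under eq_Rintegral do rewrite big_nil; rewrite Rintegral_cstT big_nil.
under eq_Rintegral do rewrite big_cons.
by rewrite big_cons mbounded_RintegralD ?IH//; exact: mbounded_sum.
Qed.

Lemma mbounded_expectation f : mbounded Q f -> 'E_P[f]%E = (\int[P]_x f x)%:E.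
Proof.
move=> bf; rewrite unlock /Rintegral fineK//.
by apply: integrable_fin_num => //; exact: mbounded_integrable.
Qed.

End bounded_on.

(** * Change of measure for a bounded density *)

Section density.
Context {d : measure_display} {T : measurableType d} {R : realType}.
Context (P pi : probability T R) (Q : set T) (W : T -> R).
Hypotheses (mQ : measurable Q) (piQ : pi Q = 1%E) (bW : mbounded Q W)
  (PW : forall E, measurable E -> P E = (\int[pi]_(x in E) (W x)%:E)%E).

Lemma density_full : P Q = 1%E.
Proof.
have := probability_setT P; rewrite PW// => <-; rewrite PW//.
rewrite (@negligible_integral _ _ _ _ setT (~` Q)) ?setTD ?setCK//.
- exact: measurableC.
- exact: (mbounded_integrable mQ).
- exact: full_setC.
Qed.

(** The Radon-Nikodym derivative of [P] equals [W] almost everywhere, because both have the same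
    integral over every measurable set. *)
Lemma Rintegral_density f : mbounded Q f -> \int[P]_x f x = \int[pi]_x (f x * W x).
Proof.
have Ppi : P `<< pi.
  apply/null_content_dominatesP => E mE piE0; rewrite PW//.
  rewrite (@negligible_integral _ _ _ _ E E) ?setDv ?integral_set0//.
  apply: (@integrableS _ _ _ pi setT) => //.
  exact: (mbounded_integrable mQ).
move=> bf.
have ge0 g : mbounded Q g -> (forall x, 0 <= g x) -> (\int[P]_x (g x)%:E = \int[pi]_x
  (g x * W x)%:E)%E.
  move=> [mg _] g0.
  rewrite -(Radon_Nikodym_SigmaFinite.change_of_variables Ppi)//; last exact/measurable_EFinP.
  have : ae_eq pi setT (Radon_Nikodym_SigmaFinite.f P pi) (EFin \o W).
    apply: integral_ae_eq => //.
    - exact: Radon_Nikodym_SigmaFinite.f_integrable.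
    - by apply/measurable_EFinP; case: bW.
    - by move=> E _ mE; rewrite -Radon_Nikodym_SigmaFinite.f_integral//; exact: PW.
  move=> ae; apply: ae_eq_integral => //.
  - apply: emeasurable_funM; first exact/measurable_EFinP.
    exact: measurable_int (Radon_Nikodym_SigmaFinite.f_integrable _).
  - by apply/measurable_EFinP/measurable_funM => //; case: bW.
  - by apply: filterS ae => x /(_ I) /= xE _; rewrite xE EFinM.
have bp : mbounded Q (fun x => `|f x|) by exact: mbounded_norm.
have bq : mbounded Q (fun x => `|f x| - f x) by exact: mboundedB.
(* [ge0] covers nonnegative functions; f is a difference of two such functions, both bounded on
   [Q]. *)
have -> : \int[P]_x f x = \int[P]_x (`|f x| - (`|f x| - f x)).
  by apply: eq_Rintegral => x _; rewrite opprB addrC subrK.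
rewrite (mbounded_RintegralB mQ)//; last exact: density_full.
have -> : \int[pi]_x (f x * W x) = \int[pi]_x (`|f x| * W x - (`|f x| - f x) * W x).
  by apply: eq_Rintegral => x _; ring.
have bpW := mboundedM bp bW; have bqW := mboundedM bq bW.
rewrite (mbounded_RintegralB mQ piQ bpW bqW).
by rewrite /Rintegral !ge0// => x; rewrite subr_ge0 ler_norm.
Qed.

End density.

(** * The log-Laplace transform *)

Lemma mvt_between {R : realType} (f df : R -> R) :
  (forall x : R, is_derive x 1 f (df x)) -> forall a b,
  exists2 c, Num.min a b <= c <= Num.max a b & f b - f a = df c * (b - a).
Proof.
move=> fd.
have fc (a b : R) : {within `[a, b], continuous f}.
  by apply: derivable_within_continuous => x _; case: (fd x).
have le a b : a <= b -> exists2 c, a <= c <= b & f b - f a = df c * (b - a).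
  move=> ab; have [c cab E] := @MVT_segment _ f df _ _ ab (fun x _ => fd x) (fc _ _).
  by exists c => //; move: cab; rewrite in_itv.
move=> a b; have [ab|/ltW ba] := leP a b.
  exact: le.
have [c cab E] := le _ _ ba; exists c => //.
by rewrite -opprB E; ring.
Qed.

Lemma Rintegral_indicT {d} {T : measurableType d} {R : realType}
  (P : probability T R) (A : set T) : measurable A ->
  \int[P]_x \1_A x = fine (P A).
Proof. by move=> mA; rewrite /Rintegral integral_indic// setIT. Qed.

Section tilt.
Context {R : realType} (mu : probability R R).

(** [tilt 0] is the Laplace transform exp(psi). [tmean] and [tvar] are the mean and variance of the
    exponentially tilted measure, that is psi' and psi''. *)
Definition tilt k (t : R) : R := \int[mu]_z (z ^+ k * expR (t * z)).
Definition tmean t := tilt 1 t / tilt 0 t.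
Definition tvar t := tilt 2 t / tilt 0 t - tmean t ^+ 2.

Let Q : set R := `[-1, 1]%classic.

Let QP (x : R) : Q x -> -1 <= x <= 1.
Proof. by rewrite /Q /= in_itv. Qed.

Let Qnorm (x : R) : Q x -> `|x| <= 1.
Proof. by move/QP; rewrite ler_norml. Qed.

Let mQ : measurable Q. Proof. exact: measurable_itv. Qed.

Lemma mbounded_tilt k (t : R) : mbounded Q (fun z => z ^+ k * expR (t * z)).
Proof.
have bid : mbounded Q id by split=> //; exists 1.
by apply: mboundedM; [exact: mboundedX|apply: mbounded_expR; exact: mboundedZ].
Qed.

Hypothesis muQ : mu Q = 1%E.

(** Differentiation under the integral on the window ]t - 1, t + 1[. Since |z| <= 1 there, the
    constant exp(|t| + 1) dominates all the derivatives. *)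
Lemma is_derive_tilt k (t : R) : is_derive t 1 (tilt k) (tilt k.+1 t).
Proof.
pose f (x y : R) := y ^+ k * expR (x * y).
have fder (x y : R) : is_derive x 1 (f^~ y) (y ^+ k.+1 * expR (x * y)).
  have : is_derive x 1 (fun x : R => y ^+ k * expR (x * y)) (y ^+ k *: (y *: expR (x * y))).
    apply: is_deriveZ; apply: is_derive_eq.
    by rewrite /GRing.scale /=; ring.
  by rewrite /f exprSr -mulrA.
have inQ x l : mu.-integrable Q (EFin \o fun y : R => y ^+ l * expR (x * y)).
  apply: (@integrableS _ _ _ mu setT) => //.
  by apply: (mbounded_integrable mQ) => //; exact: mbounded_tilt.
have Ia : `]t - 1, t + 1[%classic t by rewrite /= in_itv /= gtrBl ltrDl ltr01.
pose G : R -> R := cst (expR (`|t| + 1)).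
have G0 y : 0 <= G y by rewrite expR_ge0.
have iG : mu.-integrable Q (EFin \o G).
  apply: (@integrableS _ _ _ mu setT) => //.
  by apply: (mbounded_integrable mQ) => //; exact: mbounded_cst.
have df (x y : R) : `]t - 1, t + 1[%classic x -> Q y -> derivable (f^~ y) x 1.
  by move=> _ _; case: (fder x y).
have pE (x y : R) : partial1of2 f x y = y ^+ k.+1 * expR (x * y).
  by rewrite partial1of2E; case: (fder x y).
have Gub (x y : R) : `]t - 1, t + 1[%classic x -> Q y -> `|partial1of2 f x y| <= G y.
  rewrite /= in_itv /= => /andP[x1 x2] Qy; rewrite pE normrM (ger0_norm (expR_ge0 _)).
  rewrite -[leRHS]mul1r ler_pM ?expR_ge0//.
    by rewrite normrX exprn_ile1// Qnorm.
  rewrite ler_expR (le_trans (ler_norm _))// normrM -[leRHS]mulr1 ler_pM ?Qnorm//.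
  by rewrite -lerBlDl (le_trans (lerB_dist _ _))// ler_norml; apply/andP; split; lra.
have FE l x : tilt l x = \int[mu]_(y in Q) (y ^+ l * expR (x * y)).
  by rewrite /tilt (mbounded_Rintegral mQ muQ)//; exact: mbounded_tilt.
have -> : tilt k = (fun x' : R => \int[mu]_(y in Q) f x' y) by apply/funext => x; rewrite FE.
have intf x : `]t - 1, t + 1[%classic x -> mu.-integrable Q (EFin \o f x).
  by move=> _; exact: inQ.
apply: DeriveDef.
  exact: (derivable_under_integral mQ Ia intf df G0 iG Gub).
rewrite -derive1E (differentiation_under_integral mQ Ia intf df G0 iG Gub) FE.
by apply: eq_Rintegral => y _; rewrite pE.
Qed.

Lemma tilt0_gt0 t : 0 < tilt 0 t.
Proof.
apply: (@lt_le_trans _ _ (expR (- `|t|))); first exact: expR_gt0.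
rewrite -[leLHS](Rintegral_cstT mu); apply: (mbounded_le_Rintegral mQ muQ).
- exact: mbounded_cst.
- exact: mbounded_tilt.
move=> z Qz; rewrite expr0 mul1r ler_expR.
rewrite lerNl (le_trans (ler_norm _))// normrN normrM.
by rewrite -[leRHS]mulr1 ler_pM ?Qnorm.
Qed.

Let N0 t : tilt 0 t != 0 := lt0r_neq0 (tilt0_gt0 t).

Lemma tilt_ratio k t : `|tilt k t / tilt 0 t| <= 1.
Proof.
rewrite normrM normfV (gtr0_norm (tilt0_gt0 t)) ler_pdivrMr ?tilt0_gt0// mul1r.
rewrite (le_trans (le_normr_Rintegral _ _))//.
  by apply: (mbounded_integrable mQ) => //; exact: mbounded_tilt.
apply: (mbounded_le_Rintegral mQ muQ); [exact/mbounded_norm/mbounded_tilt|exact: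
  mbounded_tilt|].
move=> z Qz; rewrite normrM (ger0_norm (expR_ge0 _)) ler_pM ?expR_ge0//.
by rewrite expr0 normrX exprn_ile1// Qnorm.
Qed.

Lemma is_derive_tmean (t : R) : is_derive t 1 tmean (tvar t).
Proof.
have d0 := is_derive_tilt 0 t; have d1 := is_derive_tilt 1 t.
have dv := is_deriveV (N0 t) d0.
refine (is_derive_eq (is_deriveM d1 dv : is_derive t 1 tmean _) _).
by rewrite /tvar /tmean /GRing.scale /=; field.
Qed.

(** The third cumulant psi''', in the form that the quotient rule produces. *)
Definition tvar' t := tilt 3 t / tilt 0 t - tilt 2 t / tilt 0 t * tmean t
  - 2 * tmean t * tvar t.

Lemma is_derive_tvar (t : R) : is_derive t 1 tvar (tvar' t).
Proof.
have d0 := is_derive_tilt 0 t; have d2 := is_derive_tilt 2 t.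
have dv := is_deriveV (N0 t) d0.
have dm := is_derive_tmean t.
have dx := is_deriveX 2 dm.
refine (is_derive_eq (is_deriveB (is_deriveM d2 dv) dx : is_derive t 1 tvar _) _).
by rewrite /tvar' /tvar /tmean /GRing.scale /=; field.
Qed.

Lemma tmean_norm t : `|tmean t| <= 1. Proof. exact: tilt_ratio. Qed.

Lemma tvar_ge0 t : 0 <= tvar t.
Proof.
have E : tvar t = (\int[mu]_z ((z - tmean t) ^+ 2 * expR (t * z))) / tilt 0 t.
  have -> : \int[mu]_z ((z - tmean t) ^+ 2 * expR (t * z)) =
     tilt 2 t - 2 * tmean t * tilt 1 t + tmean t ^+ 2 * tilt 0 t.
    have b k c := mboundedZ c (mbounded_tilt k t).
    rewrite /tilt -(mbounded_RintegralZl mQ muQ (2 * tmean t) (mbounded_tilt 1 t)).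
    rewrite -(mbounded_RintegralZl mQ muQ (tmean t ^+ 2) (mbounded_tilt 0 t)).
    rewrite -(mbounded_RintegralB mQ muQ (mbounded_tilt 2 t) (b 1%N (2 * tmean t))).
    rewrite -(mbounded_RintegralD mQ muQ (mboundedB (mbounded_tilt 2 t) (b 1%N (2 *
      tmean t))) (b 0%N (tmean t ^+ 2))).
    by apply: eq_Rintegral => z _; ring.
  by rewrite /tvar /tmean; field.
rewrite E divr_ge0 ?(ltW (tilt0_gt0 _))//; apply: Rintegral_ge0 => z _.
by rewrite mulr_ge0 ?sqr_ge0 ?expR_ge0.
Qed.

Lemma tvar_le1 t : tvar t <= 1.
Proof.
have := tilt_ratio 2 t; rewrite ler_norml => /andP[_ h].
by rewrite /tvar lerBlDr (le_trans h)// lerDl sqr_ge0.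
Qed.

(** The three terms are at most 1, 1 and 2 in absolute value. *)
Lemma tvar'_norm t : `|tvar' t| <= 4.
Proof.
have := tilt_ratio 3 t; have := tilt_ratio 2 t; have := tmean_norm t.
have := tvar_ge0 t; have := tvar_le1 t; rewrite /tvar'.
move: (tilt 3 t / _) (tilt 2 t / _) (tmean t) (tvar t) => a b c d h1 h2 h3 h4 h5.
have bc : `|b * c| <= 1 by rewrite normrM -[leRHS]mulr1 ler_pM.
have cd : `|2 * c * d| <= 2.
  rewrite !normrM (ger0_norm h2) (ger0_norm (ler0n _ 2)) -mulrA -[leRHS]mulr1 ler_pM
    ?mulr_ge0//.
  by rewrite -[leRHS]mulr1 ler_pM.
by move: h5 bc cd; rewrite !ler_norml => /andP[? ?] /andP[? ?] /andP[? ?]; apply/andP;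
  split; lra.
Qed.

Lemma tmean_homo : {homo tmean : x y / x <= y}.
Proof.
move=> x y xy; have [c _ E] := mvt_between is_derive_tmean x y.
by rewrite -subr_ge0 E mulr_ge0 ?tvar_ge0 ?subr_ge0.
Qed.

Lemma tmean_lip x y : `|tmean x - tmean y| <= `|x - y|.
Proof.
have [c _ ->] := mvt_between is_derive_tmean y x.
by rewrite normrM -[leRHS]mul1r ler_pM// ger0_norm ?tvar_ge0 ?tvar_le1.
Qed.

Lemma tvar_lip x y : `|tvar x - tvar y| <= 4 * `|x - y|.
Proof.
have [c _ ->] := mvt_between is_derive_tvar y x.
by rewrite normrM ler_pM// tvar'_norm.
Qed.

(** One mean value step followed by the Lipschitz bound on [tvar]; the factor 1/2 of the exact
    remainder is given away. *)
Lemma tmean_taylor x h : `|tmean (x + h) - tmean x - tvar x * h| <= 4 * h ^+ 2.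
Proof.
have [c /andP[c1 c2] ->] := mvt_between is_derive_tmean x (x + h).
rewrite (addrC x h) addrK -mulrBl.
rewrite normrM -(real_normK (num_real h)) expr2 mulrA ler_pM//.
rewrite (le_trans (tvar_lip _ _))// ler_pM2l//.
move: c1 c2; rewrite ge_min le_max.
have [h0|h0] := lerP 0 h; rewrite ler_norml ?(ger0_norm h0) ?(ltr0_norm h0) =>
  /orP[?|?] /orP[?|?];
  by apply/andP; split; lra.
Qed.

Lemma is_derive_psi (t : R) : is_derive t 1 (psi mu) (tmean t).
Proof.
have -> : psi mu = (@ln R) \o tilt 0.
  apply/funext => x; rewrite /psi /tilt /=; congr (ln _).
  by apply: eq_Rintegral => z _; rewrite expr0 mul1r.
have d0 := is_derive_tilt 0 t.
refine (is_derive_eq (is_derive1_comp (is_derive1_ln (tilt0_gt0 t)) d0 :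
  is_derive t 1 ((@ln R) \o tilt 0) _) _).
by rewrite /tmean mulrC.
Qed.

Lemma derive1_psi : derive1 (psi mu) = tmean.
Proof. by apply/funext => t; rewrite derive1E; case: (is_derive_psi t). Qed.

Lemma psi_tangent x y : psi mu x + tmean x * (y - x) <= psi mu y.
Proof.
have [c cxy E] := mvt_between is_derive_psi x y.
move: cxy; have [xy|xy] := leP x y => /andP[c1 c2].
  rewrite -lerBrDl E ler_wpM2r ?subr_ge0//; exact: tmean_homo.
rewrite -lerBrDl E ler_wnM2r ?subr_le0//; [exact: ltW|exact: tmean_homo].
Qed.

Hypotheses (sN : msupport mu (-1)) (sP : msupport mu 1).

Lemma support_sign s : s = 1 \/ s = -1 -> msupport mu s.
Proof. by case=> ->. Qed.

Lemma open_mass (U : set R) s : s = 1 \/ s = -1 -> open U -> U s -> 0 < fine (mu U).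
Proof.
move=> /support_sign ss oU Us; apply: fine_gt0; rewrite ss//=.
by rewrite (le_lt_trans (probability_le1 _ _)) ?ltry//; exact: open_measurable.
Qed.

Lemma open_half s (y : R) : open [set z : R | y < s * z].
Proof.
have cs : continuous (fun z : R => s * z) by move=> z; exact: mulrl_continuous.
rewrite (_ : [set _ | _] = (fun z => s * z) @^-1` [set z | y < z])//.
by apply: open_comp => //; exact: open_gt.
Qed.

Lemma mbounded_lin (a b t : R) : mbounded Q (fun z => a * (z ^+ 0 * expR (t * z)) - b *
  (z ^+ 1 * expR (t * z))).
Proof. by apply: mboundedB; apply: mboundedZ; exact: mbounded_tilt. Qed.

Lemma tilt_lin (a b t : R) : a * tilt 0 t - b * tilt 1 t =
  \int[mu]_z (a * (z ^+ 0 * expR (t * z)) - b * (z ^+ 1 * expR (t * z))).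
Proof.
rewrite /tilt -(mbounded_RintegralZl mQ muQ a (mbounded_tilt 0 t))
  -(mbounded_RintegralZl mQ muQ b (mbounded_tilt 1 t)).
by rewrite -(mbounded_RintegralB mQ muQ (mboundedZ a (mbounded_tilt 0 t)) (mboundedZ b
  (mbounded_tilt 1 t))).
Qed.

(** On the cube 1 - s z is nonnegative, and it exceeds 1 on the half-line [U] around -s, which has
    positive mass because -s is in the support. The sign s treats both ends at once. *)
Lemma tmean_sign_lt1 s t : s = 1 \/ s = -1 -> s * tmean t < 1.
Proof.
move=> hs; pose U := [set z : R | 0 < - s * z].
have oU : open U by exact: open_half.
have mU : measurable U by exact: open_measurable.
have ss : s * s = 1 by case: hs => ->; ring.
have p0 : 0 < fine (mu U).
  apply: (@open_mass _ (- s)) => //; last by rewrite /U /= mulrNN ss.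
  by case: hs => ->; rewrite ?opprK; [right|left].
rewrite /tmean mulrA ltr_pdivrMr ?tilt0_gt0// mul1r -subr_gt0.
rewrite -[tilt 0 t]mul1r tilt_lin.
apply: (@lt_le_trans _ _ (expR (- `|t|) * fine (mu U))); first by rewrite mulr_gt0 ?expR_gt0.
rewrite -Rintegral_indicT// -(mbounded_RintegralZl mQ muQ _ (mbounded_indic _ mU)).
apply: (mbounded_le_Rintegral mQ muQ) => //.
- exact/mboundedZ/mbounded_indic.
- exact: mbounded_lin.
move=> z Qz; have /andP[z1 z2] := QP Qz.
have e : expR (- `|t|) <= expR (t * z).
  rewrite ler_expR lerNl (le_trans (ler_norm _))// normrN normrM.
  by rewrite -[leRHS]mulr1 ler_pM ?Qnorm.
have e0 := expR_gt0 (- `|t|).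
rewrite expr0 expr1 mul1r mulrA -mulrBl indicE.
case: (boolP (z \in U)) => [|_] /=.
  rewrite inE /U /= => zU; rewrite mulr1 -[leLHS]mul1r ler_pM//; lra.
by rewrite mulr0 mulr_ge0 ?expR_ge0//; case: hs => ->; lra.
Qed.

Lemma tmean_lt1 t : -1 < tmean t < 1.
Proof.
have := @tmean_sign_lt1 1 t (or_introl erefl).
have := @tmean_sign_lt1 (-1) t (or_intror erefl).
by move=> *; apply/andP; split; lra.
Qed.

(** A strong tilt concentrates near the support point s. With w = s z, the function (w - y) exp(t (w
    - y)) is at least e exp(t e) on [U], where w > y + e, and at least -2 elsewhere on the cube. *)
Lemma tmean_large s y : s = 1 \/ s = -1 -> `|y| < 1 -> exists2 t, 0 <= t & y <= s *
  tmean (s * t).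
Proof.
move=> hs; rewrite ltr_norml => /andP[y0 y1].
have ss : s * s = 1 by case: hs => ->; ring.
pose e := (1 - y) / 2; have e0 : 0 < e by rewrite /e; lra.
pose U := [set z : R | y + e < s * z].
have oU : open U by exact: open_half.
have mU : measurable U by exact: open_measurable.
have p0 : 0 < fine (mu U).
  by apply: (@open_mass _ s) => //; rewrite /U /= ss /e; lra.
set p := fine (mu U) in p0.
(* This makes e p exp(t e) at least 2, because exp(t e) >= 1 + 2 / (e p). *)
pose t := 2 / (e ^+ 2 * p).
have t0 : 0 <= t by rewrite divr_ge0// mulr_ge0 ?ltW// exprn_gt0.
exists t => //.
rewrite /tmean mulrA ler_pdivlMr ?tilt0_gt0// -subr_ge0.
have -> : s * tilt 1 (s * t) - y * tilt 0 (s * t) = (- y) * tilt 0 (s * t) - (- s) *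
  tilt 1 (s * t) by ring.
rewrite tilt_lin.
apply: (@le_trans _ _ (expR (t * y) * (e * expR (t * e) * p - 2))).
  rewrite mulr_ge0 ?expR_ge0// subr_ge0.
  have := expR_ge1Dx (t * e).
  have -> : t * e = 2 / (e * p) by rewrite /t; field; rewrite !gt_eqF.
  have ep : 0 < e * p by rewrite mulr_gt0.
  move=> h; have : (e * p) * (1 + 2 / (e * p)) <= (e * p) * expR (2 / (e * p))
    by rewrite ler_pM2l.
  rewrite mulrDr mulrCA divff ?gt_eqF//; lra.
rewrite /p -Rintegral_indicT// -(mbounded_RintegralZl mQ muQ _ (mbounded_indic _ mU)).
rewrite -[X in _ - X](Rintegral_cstT mu) -(mbounded_RintegralB mQ muQ (mboundedZ _
  (mbounded_indic _ mU)) (mbounded_cst _ _)).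
have b1 : mbounded Q (fun x => e * expR (t * e) * \1_U x - 2) by apply: mboundedB;
  [exact/mboundedZ/mbounded_indic|exact: mbounded_cst].
rewrite -(mbounded_RintegralZl mQ muQ _ b1).
apply: (mbounded_le_Rintegral mQ muQ) => //.
- exact: mboundedZ.
- exact: mbounded_lin.
move=> z Qz; have /andP[z1 z2] := QP Qz.
rewrite expr0 expr1 mul1r mulrA -mulrBl (_ : - y - - s * z = s * z - y); last by ring.
have -> : s * t * z = t * y + t * (s * z - y) by ring.
rewrite expRD [leRHS]mulrCA ler_pM2l ?expR_gt0//.
set w := s * z; have w1 : -1 <= w by rewrite /w; case: hs => ->; lra.
have E0 := expR_gt0 (t * (w - y)).
rewrite indicE; case: (boolP (z \in U)) => [|_] /=.
  rewrite inE /U /= -/w mulr1 => zU.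
  have h : expR (t * e) <= expR (t * (w - y)) by rewrite ler_expR ler_wpM2l//; lra.
  have := expR_gt0 (t * e); nra.
rewrite mulr0; have [h|h] := leP y w; first by nra.
have h1 : expR (t * (w - y)) <= 1.
  by rewrite -expR0 ler_expR mulr_ge0_le0//; lra.
nra.
Qed.

Lemma tmean_surj x : -1 < x < 1 -> exists t, tmean t = x.
Proof.
move=> /andP[x1 x2].
have nx : `|x| < 1 by rewrite ltr_norml x1.
have nx' : `|- x| < 1 by rewrite normrN.
have [b b0 hb] := @tmean_large 1 x (or_introl erefl) nx.
have [a a0 ha] := @tmean_large (-1) (- x) (or_intror erefl) nx'.
rewrite !mul1r in hb; rewrite !mulN1r lerN2 in ha.
have ab : - a <= b by rewrite (le_trans _ b0)// oppr_le0.
have ct : {within `[- a, b], continuous tmean}.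
  by apply: derivable_within_continuous => t _; case: (is_derive_tmean t).
have [|c _ <-] := @IVT _ tmean _ _ x ab ct; last by exists c.
by apply/andP; split; [rewrite ge_min; apply/orP; left|rewrite le_max; apply/orP; right].
Qed.

End tilt.

(** * The mean-field optimizer *)

Section rate.
Context {R : realType} (mu : probability R R).
Implicit Types (h z x y t : R).
Hypothesis bmu : base_measure mu.

Let muQ : mu `[-1, 1]%classic = 1%E. Proof. by case: bmu. Qed.
Let sN : msupport mu (-1). Proof. by case: bmu. Qed.
Let sP : msupport mu 1. Proof. by case: bmu. Qed.

(** [phi] picks some solution of psi' = z; surjectivity of [tmean] ensures that [xget] does not fall
    back on its default 0. *)
Lemma tmean_phi z : -1 < z < 1 -> tmean mu (phi mu z) = z.
Proof.
move=> /(tmean_surj muQ sN sP) [t tz].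
rewrite -(derive1_psi muQ) /phi.
have ex : exists t, [set theta | derive1 (psi mu) theta = z] t by exists t;
  rewrite /= derive1_psi.
exact: (xgetPex 0 ex).
Qed.

Lemma rate_in_ge h z : -1 < z < 1 -> z * h - psi mu h <= rate_in mu z.
Proof.
move=> z1; have := psi_tangent muQ (phi mu z) h; rewrite (tmean_phi z1) /rate_in.
by move: (phi mu z) => t; move: (psi mu h) (psi mu t) => a b; lra.
Qed.

(** The point chosen by [phi] need not be h a priori. The tangents of psi at both points show that
    the Legendre value is the same. *)
Lemma rate_in_tmean h : rate_in mu (tmean mu h) = tmean mu h * h - psi mu h.
Proof.
have h1 := tmean_lt1 muQ sN sP h.
apply: le_anti; apply/andP; split; last exact: rate_in_ge.
have := psi_tangent muQ h (phi mu (tmean mu h)); rewrite /rate_in.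
move: (tmean mu h) => x; move: (phi mu x) => t.
by move: (psi mu h) (psi mu t) => a b; lra.
Qed.

(* Equality in Fenchel's inequality makes [t |-> psi t - z t] minimal at [h]. *)
Lemma rate_in_eq h z : -1 < z < 1 -> rate_in mu z <= z * h - psi mu h ->
  z = tmean mu h.
Proof.
move=> z1 le.
have min t : z * (t - h) <= tmean mu t * (t - h).
  have := rate_in_ge t z1; have := psi_tangent muQ t h; move: le.
  by move: (psi mu h) (psi mu t) (tmean mu t) (rate_in mu z) => a b c d; lra.
(* Testing at h + e and h - e and dividing by e traps z within e of psi'(h), as psi' is
   1-Lipschitz. *)
apply/eqP; rewrite eq_le; apply/andP; split; apply/ler_addgt0Pr => e e0.
  have := min (h + e); rewrite (addrC h) addrK ler_pM2r// => /le_trans; apply.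
  have := tmean_lip muQ (e + h) h; rewrite addrK (gtr0_norm e0) ler_norml.
  by move: (tmean mu _) (tmean mu _) => a b /andP[_]; lra.
have := min (h - e); rewrite (addrC h) addrK ler_nM2r ?oppr_lt0// => tz.
have := tmean_lip muQ (- e + h) h; rewrite addrK normrN (gtr0_norm e0) ler_norml.
by move: tz; move: (tmean mu _) (tmean mu _) => a b ? /andP[? _]; lra.
Qed.

Lemma phi_ge0 z : -1 < z < 1 -> tmean mu 0 < z -> 0 <= phi mu z.
Proof.
move=> z1 tz; rewrite leNgt; apply/negP => p0.
by have := tmean_homo muQ (ltW p0); rewrite (tmean_phi z1) leNgt tz.
Qed.

Lemma phi_le0 z : -1 < z < 1 -> z < tmean mu 0 -> phi mu z <= 0.
Proof.
move=> z1 tz; rewrite leNgt; apply/negP => p0.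
by have := tmean_homo muQ (ltW p0); rewrite (tmean_phi z1) leNgt tz.
Qed.

(** To the right of the untilted mean, [phi] is nonnegative, so Fenchel's lower bound with slope
    [phi mu x] grows from x to y. Such monotonicity is what makes the limits in [rate] exist. *)
Lemma rate_in_nondecreasing x y : -1 < x < 1 -> -1 < y < 1 ->
  tmean mu 0 < x -> x <= y -> rate_in mu x <= rate_in mu y.
Proof.
move=> x1 y1 tx xy; have p0 := phi_ge0 x1 tx.
by rewrite (le_trans _ (rate_in_ge (phi mu x) y1))// /rate_in lerD2r ler_wpM2r.
Qed.

Lemma rate_in_nonincreasing x y : -1 < x < 1 -> -1 < y < 1 ->
  y < tmean mu 0 -> x <= y -> rate_in mu y <= rate_in mu x.
Proof.
move=> x1 y1 ty xy; have p0 := phi_le0 y1 ty.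
by rewrite (le_trans _ (rate_in_ge (phi mu y) x1))// /rate_in lerD2r ler_wnM2r.
Qed.

Lemma cvg_rate_right : cvg ((rate_in mu x)%:E @[x --> (-1 : R)^'+]).
Proof.
have /andP[t1 t2] := tmean_lt1 muQ sN sP 0.
apply: nonincreasing_at_right_is_cvge; near=> z => x y.
have zt : z < tmean mu 0 by near: z; exact: nbhs_right_lt.
rewrite !in_itv /= => /andP[x1 xz] /andP[y1 yz] xy; rewrite lee_fin.
have z1 := lt_trans zt t2.
apply: rate_in_nonincreasing => //.
- by rewrite x1 (lt_trans xz).
- by rewrite y1 (lt_trans yz).
- exact: lt_trans yz zt.
Unshelve. all: end_near. Qed.

Lemma cvg_rate_left : cvg ((rate_in mu x)%:E @[x --> (1 : R)^'-]).
Proof.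
have /andP[t1 t2] := tmean_lt1 muQ sN sP 0.
have : cvg ((rate_in mu (- x))%:E @[x --> (-1 : R)^'+]).
  apply: (@nonincreasing_at_right_is_cvge _ (fun x => (rate_in mu (- x))%:E)).
  near=> z => x y.
  have zt : z < - tmean mu 0 by near: z; apply: nbhs_right_lt; rewrite ltrN2.
  rewrite !in_itv /= => /andP[x1 xz] /andP[y1 yz] xy; rewrite lee_fin.
  have tx : tmean mu 0 < - y by move: yz zt; move: (tmean mu 0) => m; lra.
  by apply: rate_in_nondecreasing; [lra|lra|exact: tx|lra].
move=> /cvg_ex[l hl]; apply/cvg_ex; exists l.
exact/cvg_at_leftNP.
Unshelve. all: end_near. Qed.

Lemma psi_slope_lt a b : a < b ->
  a - b < psi mu b - psi mu a < b - a.
Proof.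
move=> ab; have [c _ ->] := mvt_between (is_derive_psi muQ) a b.
have /andP[] := tmean_lt1 muQ sN sP c.
move: (tmean mu c) => t t1 t2.
have d0 : 0 < b - a by rewrite subr_gt0.
by rewrite -[X in _ < _ < X]mul1r ltr_pM2r// t2 andbT -opprB -mulN1r ltr_pM2r.
Qed.

(** As psi' < 1, the map h - psi(h) increases strictly, so Fenchel's bound with h + 1 in place of h
    leaves a margin K - L. Half of it absorbs the loss (1 - x)(h + 1) as x tends to 1. *)
Lemma rate_1_gt h : ((h - psi mu h)%:E < rate mu 1)%E.
Proof.
have h1 : h < h + 1 by rewrite ltrDl.
have /andP[_ sl] := psi_slope_lt h1.
have psiE : psi mu (h + 1) = h + 1 - (h + 1 - psi mu (h + 1)) by rewrite subKr.
move: psiE; move LE : (h - psi mu h) => L; move KE : (h + 1 - psi mu (h + 1)) => K psiE.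
have LK : L < K by rewrite -LE -KE; move: sl; clear; move: (psi mu h) (psi mu _) => a b; lra.
clear sl LE KE.
pose M := (L + K) / 2.
apply: (@lt_le_trans _ _ M%:E); first by rewrite lte_fin /M; lra.
rewrite /rate eqxx; apply: lime_ge; first exact: cvg_rate_left.
near=> x; rewrite lee_fin.
have x1 : x < 1 by near: x; exact: nbhs_left_lt.
have x2 : -1 < x by near: x; apply: nbhs_left_gt; lra.
apply: le_trans (rate_in_ge (h + 1) _); last by rewrite x2.
rewrite psiE.
pose k := (K - L) / (2 * (`|h + 1| + 1)).
have n1 : 0 < `|h + 1| + 1 by rewrite ltr_wpDl.
have x3 : 1 - k < x.
  by near: x; apply: nbhs_left_gt; rewrite ltrBlDr ltrDl divr_gt0 ?subr_gt0// mulr_gt0.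
have hk : (1 - x) * (h + 1) <= (K - L) / 2.
  have kE : (K - L) / 2 = k * (`|h + 1| + 1) by rewrite /k; field; rewrite gt_eqF.
  rewrite kE (le_trans (ler_norm _))// normrM ler_pM//.
    by rewrite gtr0_norm ?subr_gt0//; lra.
  by rewrite lerDl.
rewrite /M; lra.
Unshelve. all: end_near. Qed.

Lemma rate_N1_gt h : ((- h - psi mu h)%:E < rate mu (-1))%E.
Proof.
have h1 : h - 1 < h by rewrite ltrBlDr ltrDl.
have /andP[sl _] := psi_slope_lt h1.
have psiE : psi mu (h - 1) = - (h - 1) - (- (h - 1) - psi mu (h - 1)) by rewrite subKr.
move: psiE; move LE : (- h - psi mu h) => L; move KE : (- (h - 1) - psi mu (h - 1)) => K psiE.
have LK : L < K by rewrite -LE -KE; move: sl; clear; move: (psi mu h) (psi mu _) => a b; lra.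
clear sl LE KE.
pose M := (L + K) / 2.
apply: (@lt_le_trans _ _ M%:E); first by rewrite lte_fin /M; lra.
rewrite /rate ifF; last by apply/negbTE/eqP => ?; lra.
rewrite eqxx; apply: lime_ge; first exact: cvg_rate_right.
near=> x; rewrite lee_fin.
have x1 : x < 1 by near: x; apply: nbhs_right_lt; lra.
have x2 : -1 < x by near: x; exact: nbhs_right_gt.
apply: le_trans (rate_in_ge (h - 1) _); last by rewrite x2.
rewrite psiE.
pose k := (K - L) / (2 * (`|h - 1| + 1)).
have n1 : 0 < `|h - 1| + 1 by rewrite ltr_wpDl.
have x3 : x < -1 + k.
  by near: x; apply: nbhs_right_lt; rewrite ltrDl divr_gt0 ?subr_gt0// mulr_gt0.
have hk : (-1 - x) * (h - 1) <= (K - L) / 2.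
  have kE : (K - L) / 2 = k * (`|h - 1| + 1) by rewrite /k; field; rewrite gt_eqF.
  rewrite kE (le_trans (ler_norm _))// normrM ler_pM//.
    by rewrite ltr0_norm ?subr_lt0//; lra.
  by rewrite lerDl.
rewrite /M; lra.
Unshelve. all: end_near. Qed.

Lemma rateE z : -1 < z < 1 -> rate mu z = (rate_in mu z)%:E.
Proof. by move=> /andP[z1 z2]; rewrite /rate (lt_eqF z2) (gt_eqF z1). Qed.

Lemma rate_ge h z : -1 <= z <= 1 -> ((z * h - psi mu h)%:E <= rate mu z)%E.
Proof.
move=> /andP[]; rewrite le_eqVlt => /predU1P[<- _|z1].
  by rewrite mulN1r ltW// rate_N1_gt.
rewrite le_eqVlt => /predU1P[->|z2]; first by rewrite mul1r ltW// rate_1_gt.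
have z12 : -1 < z < 1 by rewrite z1.
by rewrite (rateE z12) lee_fin; exact: rate_in_ge.
Qed.

(** At the endpoints Fenchel's inequality is strict, so equality by itself places z in the open
    interval. *)
Lemma rate_eq h z : -1 <= z <= 1 -> (rate mu z <= (z * h - psi mu h)%:E)%E ->
  z = tmean mu h.
Proof.
move=> /andP[]; rewrite le_eqVlt => /predU1P[<- _|z1].
  by rewrite mulN1r leNgt rate_N1_gt.
rewrite le_eqVlt => /predU1P[->|z2]; first by rewrite mul1r leNgt rate_1_gt.
by rewrite rateE ?z1// lee_fin => /rate_in_eq; apply; rewrite z1.
Qed.

Lemma rate_tmean h : rate mu (tmean mu h) = (tmean mu h * h - psi mu h)%:E.
Proof. by rewrite rateE ?rate_in_tmean//; exact: tmean_lt1. Qed.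

End rate.

(** * From maximality to the fixed-point equation *)

Section optimizer.
Context {R : realType} {n : nat}.
Implicit Types (A : 'M[R]_n) (c u v : 'cV[R]_n).

Lemma local_fieldE A v i : local_field A v i = (A *m v) i 0.
Proof. by rewrite mxE. Qed.

(** The zero diagonal removes the z^2 term and symmetry merges the two cross terms. Being affine in
    each coordinate serves twice: for the optimizer, and for the law of one spin given the
    others. *)
Lemma hamiltonian_shift A c v i (z : R) : coupling_matrix A ->
  hamiltonian A c (v + z *: delta_mx i 0) =
  hamiltonian A c v + z * (local_field A v i + c i 0).
Proof.
move=> [AT A0]; rewrite /hamiltonian local_fieldE.
have E w : (w^T *m (delta_mx i 0 : 'cV_n)) 0 0 = w i 0 :> R.
  by rewrite -colE !mxE.
have E' (w : 'cV[R]_n) : ((delta_mx i 0 : 'cV_n)^T *m w) 0 0 = w i 0.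
  by rewrite trmx_delta -rowE mxE.
have mxD (B C : 'M[R]_1) : (B + C) 0 0 = B 0 0 + C 0 0 by rewrite mxE.
have mxZ a (B : 'M[R]_1) : (a *: B) 0 0 = a * B 0 0 by rewrite mxE.
have h1 : (v^T *m A *m (delta_mx i 0 : 'cV_n)) 0 0 = (A *m v) i 0.
  by rewrite -[v^T *m A]trmxK E trmx_mul AT trmxK.
have -> : (v + z *: delta_mx i 0)^T = v^T + z *: (delta_mx i 0 : 'cV_n)^T.
  by rewrite linearD linearZ.
rewrite !(mulmxDl, mulmxDr) -!(scalemxAl, scalemxAr).
have h2 : ((delta_mx i 0 : 'cV_n)^T *m A *m v) 0 0 = (A *m v) i 0 by rewrite -mulmxA E'.
have h3 : ((delta_mx i 0 : 'cV_n)^T *m A *m (delta_mx i 0 : 'cV_n)) 0 0 = A i i.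
  by rewrite -mulmxA E' -colE mxE.
rewrite !(mxD, mxZ) h1 h2 h3 A0 E.
by field.
Qed.

(** The competitor t has finite penalty, which forces that of u to be finite: otherwise F(u) = -oo.
    Only then may the terms of the other coordinates be cancelled in the extended reals. *)
Lemma penalty_le (rt : 'I_n -> R -> \bar R) A c u i (t : 'cV[R]_n) (w : R) :
  coupling_matrix A ->
  let F v := ((hamiltonian A c v)%:E - \sum_j rt j (v j 0)%R)%E in
  let h := local_field A u i + c i 0 in
  (forall j, rt j (u j 0) != -oo%E) -> (forall j, rt j (t j 0) \is a fin_num) ->
  rt i w \is a fin_num ->
  (F t <= F u)%E -> (F (u + (w - u i 0) *: delta_mx i 0)%R <= F u)%E ->
  (rt i (u i 0)%R <= ((u i 0 - w) * h)%R%:E + rt i w)%E.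
Proof.
move=> cA F h uN tf wf Ft Fv.
have tE j : rt j (t j 0) = (fine (rt j (t j 0)))%:E by rewrite fineK.
have uf j : rt j (u j 0) \is a fin_num.
  move: Ft; rewrite /F; under eq_bigr do rewrite tE.
  rewrite sumEFin fin_numE uN /=; apply: contraTN => /eqP rj.
  suff -> : (\sum_j rt j (u j 0)%R)%E = +oo%E by [].
  by apply/esum_eqyP => //; exists j; split => //; exact: mem_index_enum.
have uE j : rt j (u j 0) = (fine (rt j (u j 0)))%:E by rewrite fineK.
have wE : rt i w = (fine (rt i w))%:E by rewrite fineK.
have vE j : (u + (w - u i 0) *: delta_mx i 0) j 0 = if j == i then w else u j 0.
  rewrite !mxE eqxx andbT; case: eqP => [->|_]; rewrite ?mulr1 ?mulr0 ?addr0//.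
  by rewrite addrC subrK.
move: Fv; rewrite /F hamiltonian_shift// -/h.
rewrite (bigD1 i)//= [X in (_ <= _ - X)%E](bigD1 i)//= vE eqxx.
under eq_bigr => j ji do rewrite vE (negbTE ji) uE.
under [X in (_ <= _ - (_ + X))%E]eq_bigr do rewrite uE.
rewrite uE wE !sumEFin -!EFinD !lee_fin.
lra.
Qed.

(** Moving coordinate i of u to psi_i'(h), where z h - I_i(z) attains the value psi_i(h), yields
    equality in Fenchel's inequality at u_i. *)
Lemma optimizer_tmean (mu : 'I_n -> probability R R) A c u i :
  (forall i, base_measure (mu i)) -> coupling_matrix A ->
  mean_field_optimizer mu A c u ->
  u i 0 = tmean (mu i) (local_field A u i + c i 0).
Proof.
move=> bmu cA [cu opt]; set h := _ + c i 0.
have uN j : rate (mu j) (u j 0) != -oo%E.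
  by have := rate_ge (bmu j) 0 (cu j); case: (rate _ _).
(* The vector of untilted means is a point of the cube where all rates are finite. *)
pose t : 'cV[R]_n := \col_j tmean (mu j) 0.
have tm1 j y : -1 <= tmean (mu j) y <= 1.
  have [muQ _ sN sP] := bmu j.
  by have /andP[/ltW -> /ltW ->] := tmean_lt1 muQ sN sP y.
have ct : cube t by move=> k; rewrite mxE.
have tf j : rate (mu j) (t j 0) \is a fin_num by rewrite mxE (rate_tmean (bmu j)).
have wf : rate (mu i) (tmean (mu i) h) \is a fin_num by rewrite (rate_tmean (bmu i)).
have cv : cube (u + (tmean (mu i) h - u i 0) *: delta_mx i 0).
  move=> j; rewrite !mxE eqxx andbT; case: eqP => [->|_].
    by rewrite mulr1 addrC subrK.
  by rewrite mulr0 addr0; exact: cu.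
apply: (rate_eq (bmu i) (cu i)).
apply: le_trans (penalty_le (rt := fun j => rate (mu j)) cA uN tf wf (opt _ ct) (opt _ cv)) _.
rewrite (rate_tmean (bmu i)) -EFinD lee_fin -/h.
move: (psi (mu i) h) => p; move: (tmean (mu i) h) => w; clear; lra.
Qed.

End optimizer.

(** * Operator norms *)

Section opnorm.
Context {R : realType}.

Definition psum k n (v : 'cV[R]_n) : R := \sum_i `|v i 0| ^+ k.

Lemma psum_ge0 k n (v : 'cV[R]_n) : 0 <= psum k v.
Proof. by apply: sumr_ge0 => i _; rewrite exprn_ge0. Qed.

Lemma psum_coord k n (v : 'cV[R]_n) i : `|v i 0| ^+ k <= psum k v.
Proof.
by rewrite /psum (bigD1 i)//= lerDl sumr_ge0// => j _; rewrite exprn_ge0.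
Qed.

Lemma psumZ k n (a : R) (v : 'cV[R]_n) : psum k (a *: v) = `|a| ^+ k * psum k v.
Proof. by rewrite /psum mulr_sumr; apply: eq_bigr => i _; rewrite mxE normrM exprMn. Qed.

Lemma lpnormE k n (v : 'cV[R]_n) : lpnorm k%:R v = psum k v `^ k%:R^-1.
Proof.
by rewrite /lpnorm /psum; congr (_ `^ _); apply: eq_bigr => i _; rewrite powR_mulrn.
Qed.

Lemma lpnorm_exp k n (v : 'cV[R]_n) : (0 < k)%N -> lpnorm k%:R v ^+ k = psum k v.
Proof.
move=> k0; rewrite lpnormE -powR_mulrn ?powR_ge0// -powRrM mulVf ?pnatr_eq0 -?lt0n//.
by rewrite powRr1// psum_ge0.
Qed.

Lemma lpnorm_le k n (v : 'cV[R]_n) (a : R) : (0 < k)%N -> 0 <= a ->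
  (lpnorm k%:R v <= a) = (psum k v <= a ^+ k).
Proof.
by move=> k0 a0; rewrite -lpnorm_exp// ler_pXn2r// nnegrE// lpnormE powR_ge0.
Qed.

Lemma mulmx_norm n (A : 'M[R]_n) (v : 'cV[R]_n) (b : R) i :
  (forall j, `|v j 0| <= b) -> `|(A *m v) i 0| <= (\sum_j `|A i j|) * b.
Proof.
move=> vb; rewrite mxE (le_trans (ler_norm_sum _ _ _))// mulr_suml ler_sum// => j _.
by rewrite normrM ler_wpM2l.
Qed.

(** Normalising v brings it into the unit ball, hence the separate case of norm 0. Powers of norms
    keep roots out of sums over coordinates. *)
Lemma opnorm_lp k n (A : 'M[R]_n) (rho : R) : (0 < k)%N -> 0 <= rho ->
  opnorm (@lpnorm R k%:R n) A <= rho ->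
  forall v, psum k (A *m v) <= rho ^+ k * psum k v.
Proof.
move=> k0 rho0 Ar v.
have [v0|v0] := eqVneq (psum k v) 0.
  have vz j : `|v j 0| <= 0.
    by rewrite -(@ler_pXn2r _ k)// ?nnegrE// expr0n (gtn_eqF k0) mulr0n -v0 psum_coord.
  rewrite v0 mulr0 /psum big1// => i _.
  have := mulmx_norm A i vz; rewrite mulr0 normr_le0 => /eqP ->.
  by rewrite normr0 expr0n (gtn_eqF k0).
have vp : 0 < psum k v by rewrite lt_def v0 psum_ge0.
set t := lpnorm k%:R v.
have tk : t ^+ k = psum k v by rewrite lpnorm_exp.
have t0 : 0 < t.
  rewrite lt_def; apply/andP; split; last by rewrite /t lpnormE powR_ge0.
  by apply: contraNneq v0 => t0; rewrite -tk t0 expr0n (gtn_eqF k0).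
pose w := t^-1 *: v.
have w1 : lpnorm k%:R w <= 1.
  by rewrite lpnorm_le// /w psumZ -tk normfV (gtr0_norm t0) -exprMn mulVf ?gt_eqF.
(* The supremum bounds its set only if that set has an upper bound; absolute row sums provide one,
   since coordinates in the unit ball are at most 1. *)
have ub : has_ubound [set lpnorm k%:R (A *m v) | v in [set v : 'cV_n | lpnorm k%:R v <= 1]].
  exists ((\sum_i (\sum_j `|A i j|) ^+ k) `^ k%:R^-1) => _ [x /= x1 <-].
  rewrite lpnormE ge0_ler_powR ?invr_ge0 ?ler0n ?nnegrE ?psum_ge0//.
    by apply: sumr_ge0 => i _; rewrite exprn_ge0// sumr_ge0.
  apply: ler_sum => i _; rewrite ler_pXn2r ?nnegrE ?sumr_ge0//.
  rewrite -[leRHS]mulr1; apply: mulmx_norm => j.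
  rewrite -(@expr_le1 _ k)// (le_trans (psum_coord _ _ _))//.
  by rewrite lpnorm_le// expr1n in x1.
have : lpnorm k%:R (A *m w) <= rho.
  by apply: le_trans Ar; apply: ub_le_sup => //; exists w.
rewrite lpnorm_le// /w -scalemxAr psumZ normfV (gtr0_norm t0) exprVn tk.
by rewrite mulrC ler_pdivrMr.
Qed.

(** The return direction: [concentration_constant] asks for the operator norm itself, while (c)
    reaches the l_2 bound as a contraction. *)
Lemma opnorm_l2_le n (A : 'M[R]_n) (rho : R) : 0 <= rho ->
  (forall v : 'cV[R]_n, psum 2 (A *m v) <= rho ^+ 2 * psum 2 v) ->
  opnorm (@lpnorm R 2 n) A <= rho.
Proof.
move=> rho0 h.
have E (w : 'cV[R]_n) a : 0 <= a -> (lpnorm 2 w <= a) = (psum 2 w <= a ^+ 2).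
  by move=> a0; exact: (@lpnorm_le 2).
apply: ge_sup.
  exists (lpnorm 2 (A *m 0)); exists 0 => //; rewrite /mkset (E 0 1 ler01) expr1n.
  by rewrite /psum big1// => i _; rewrite mxE normr0 expr0n.
move=> _ [v v1 <-]; rewrite (E (A *m v) rho rho0).
have {}v1 : psum 2 v <= 1 by rewrite -[leRHS](expr1n _ 2) -(E v 1 ler01).
by apply: le_trans (h v) _; rewrite -[leRHS]mulr1 ler_wpM2l// exprn_ge0.
Qed.

Lemma linfnorm_coord n (v : 'cV[R]_n) i : `|v i 0| <= linfnorm v.
Proof. exact: (@le_bigmax _ _ _ 0 (fun i => `|v i 0|)). Qed.

Lemma linfnorm_le n (v : 'cV[R]_n) (b : R) : 0 <= b ->
  (forall i, `|v i 0| <= b) -> linfnorm v <= b.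
Proof. by move=> b0 vb; apply: bigmax_le. Qed.

Lemma linfnorm_ge0 n (v : 'cV[R]_n) : 0 <= linfnorm v.
Proof. exact: bigmax_ge_id. Qed.

Lemma opnorm_linf n (A : 'M[R]_n) (rho : R) : opnorm (@linfnorm R n) A <= rho ->
  forall i, \sum_j `|A i j| <= rho.
Proof.
(* The signs of row i make coordinate i of A w equal to the absolute row sum. *)
move=> Ar i; pose w : 'cV[R]_n := \col_j Num.sg (A i j).
have sg1 j : `|Num.sg (A i j)| <= 1.
  by rewrite normr_sg; case: (_ != 0).
have ub : has_ubound [set linfnorm (A *m v) | v in [set v : 'cV_n | linfnorm v <= 1]].
  exists (\sum_i \sum_j `|A i j|) => _ [x /= x1 <-].
  apply: linfnorm_le => [|k]; first by do 2 (apply: sumr_ge0 => ? _).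
  have xk j : `|x j 0| <= 1 by rewrite (le_trans (linfnorm_coord _ _)).
  rewrite (le_trans (mulmx_norm _ _ xk))// mulr1 [leRHS](bigD1 k)//= lerDl.
  by do 2 (apply: sumr_ge0 => ? _).
apply: le_trans Ar; apply: (@le_trans _ _ (linfnorm (A *m w))).
  apply: le_trans (linfnorm_coord _ i); rewrite mxE.
  apply: le_trans (ler_norm _); apply: ler_sum => j _.
  by rewrite mxE mulrC -normrEsg.
apply: ub_le_sup => //; exists w => //=.
by apply: linfnorm_le => // j; rewrite mxE.
Qed.

Lemma cauchy_schwarz n (a b : 'I_n -> R) :
  (\sum_i a i * b i) ^+ 2 <= (\sum_i a i ^+ 2) * (\sum_i b i ^+ 2).
Proof.
have [b0|b0] := eqVneq (\sum_i b i ^+ 2) 0.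
  have bz i : b i = 0.
    apply/eqP; rewrite -sqrf_eq0 eq_le sqr_ge0 andbT -b0 (bigD1 i)//= lerDl.
    by apply: sumr_ge0 => j _; rewrite sqr_ge0.
  by rewrite b0 mulr0 big1 ?expr0n// => i _; rewrite bz mulr0.
have bp : 0 < \sum_i b i ^+ 2 by rewrite lt_def b0 sumr_ge0// => i _; rewrite sqr_ge0.
set X := \sum_i a i * b i; set B := \sum_i b i ^+ 2 in b0 bp *; set A := \sum_i a i ^+ 2.
have : 0 <= \sum_i (a i - X / B * b i) ^+ 2 by apply: sumr_ge0 => i _; rewrite sqr_ge0.
have -> : \sum_i (a i - X / B * b i) ^+ 2 = A - X ^+ 2 / B.
  transitivity (A - 2 * (X / B) * X + (X / B) ^+ 2 * B); last by field.
  rewrite /A /X /B !mulr_sumr -sumrB -big_split /=; apply: eq_bigr => i _.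
  by rewrite -/X -/B; ring.
by rewrite subr_ge0 ler_pdivrMr.
Qed.

Lemma psum2E n (v : 'cV[R]_n) : psum 2 v = \sum_i v i 0 ^+ 2.
Proof. by apply: eq_bigr => i _; rewrite real_normK ?num_real. Qed.

(* [|Ax|^2 <= |x| |A^2 x|] makes [k |-> |A^k x|] log-convex, so its first ratio
   is at most its exponential growth rate, which any other norm computes. *)
Lemma symmetric_l2_le n (A : 'M[R]_n) (rho K : R) (g : 'cV[R]_n -> R) :
  A^T = A -> 0 < rho -> 0 <= K -> (forall v, psum 2 v <= K * g v) ->
  (forall v, g (A *m v) <= rho ^+ 2 * g v) ->
  forall v, psum 2 (A *m v) <= rho ^+ 2 * psum 2 v.
Proof.
move=> AT rho0 K0 qg gA v; rewrite leNgt; apply/negP => lt.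
have r2 : 0 < rho ^+ 2 by rewrite exprn_gt0.
have lc w : psum 2 (A *m w) ^+ 2 <= psum 2 w * psum 2 (A *m (A *m w)).
  rewrite [X in X ^+ 2](_ : _ = \sum_i w i 0 * (A *m (A *m w)) i 0).
    by rewrite !psum2E; exact: cauchy_schwarz.
  rewrite psum2E.
  transitivity (((A *m w)^T *m (A *m w)) 0 0).
    by rewrite mxE; apply: eq_bigr => i _; rewrite [(_^T) _ _]mxE expr2.
  by rewrite trmx_mul AT -mulmxA mxE; apply: eq_bigr => i _; rewrite [(_^T) _ _]mxE.
have v0 : 0 < psum 2 v.
  rewrite lt_def psum_ge0 andbT; apply: contraTneq lt => v0.
  have := lc v; rewrite v0 mul0r mulr0 -leNgt => h.
  have : psum 2 (A *m v) ^+ 2 == 0 by rewrite eq_le h sqr_ge0.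
  by rewrite sqrf_eq0 => /eqP ->.
set x := fun k => iter k (mulmx A) v.
set l := psum 2 (A *m v) / psum 2 v.
have l0 : rho ^+ 2 < l by rewrite /l ltr_pdivlMr.
have lp : 0 < l by exact: lt_trans l0.
have step k : 0 < psum 2 (x k) /\ l * psum 2 (x k) <= psum 2 (x k.+1).
  elim: k => [|k [pk lk]]; first by split => //; rewrite /l /= mulfVK ?gt_eqF.
  have pk1 : 0 < psum 2 (x k.+1) by exact: lt_le_trans (mulr_gt0 lp pk) lk.
  split => //; have := lc (x k); rewrite -[A *m x k]/(x k.+1) -[A *m x k.+1]/(x k.+2) => h.
  rewrite -(ler_pM2l pk); apply: le_trans h; rewrite expr2 mulrA (mulrC (psum 2 (x k))).
  by rewrite ler_pM2r.
have lo k : l ^+ k * psum 2 v <= psum 2 (x k).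
  elim: k => [|k IH]; first by rewrite mul1r.
  rewrite exprS -mulrA; apply: le_trans (step k).2.
  by rewrite ler_pM2l.
have hi k : g (x k) <= (rho ^+ 2) ^+ k * g v.
  elim: k => [|k IH]; first by rewrite mul1r.
  by apply: le_trans (gA _) _; rewrite [_ ^+ k.+1]exprS -mulrA ler_pM2l.
(* If the first ratio l exceeded rho^2, the powers (1 + e)^k = (l / rho^2)^k would all stay below
   the constant [B], contradicting Bernoulli's inequality. *)
set e := l / rho ^+ 2 - 1.
have e0 : 0 < e by rewrite subr_gt0 ltr_pdivlMr ?mul1r.
have bern k : 1 + k%:R * e <= (1 + e) ^+ k.
  elim: k => [|k IH]; first by rewrite mul0r addr0.
  rewrite exprS; apply: (@le_trans _ _ ((1 + e) * (1 + k%:R * e)));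
    last by rewrite ler_pM2l// addr_gt0.
  have : 0 <= e * (k%:R * e) by rewrite !mulr_ge0// ltW.
  by rewrite -natr1; lra.
set B := K * g v / psum 2 v.
have bnd k : (1 + e) ^+ k <= B.
  rewrite /e addrC subrK ler_pdivlMr// expr_div_n mulrAC ler_pdivrMr ?exprn_gt0//.
  rewrite (le_trans (lo k))// (le_trans (qg _))// -mulrA ler_wpM2l// mulrC; exact: hi.
have := le_trans (bern _) (bnd (Num.bound (B / e))).
have B0 : 0 <= B by apply: le_trans (bnd 0); rewrite expr0.
have := archi_boundP (divr_ge0 B0 (ltW e0)); rewrite ltr_pdivrMr//.
move: (_%:R * e) => a; lra.
Qed.

(** The comparison norm g is the squared l_4 norm, homogeneous of degree 2 like [psum 2]. The crude
    factor n is harmless, since [symmetric_l2_le] does not pass K on to its conclusion. *)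
Lemma l2_le_l4 n (A : 'M[R]_n) (rho : R) : A^T = A -> 0 < rho ->
  (forall v, psum 4 (A *m v) <= rho ^+ 4 * psum 4 v) ->
  forall v, psum 2 (A *m v) <= rho ^+ 2 * psum 2 v.
Proof.
move=> AT rho0 h4.
apply: (@symmetric_l2_le _ A rho n%:R (fun v => Num.sqrt (psum 4 v))) => // v.
- rewrite -[n in n%:R]card_ord mulr_natl -sumr_const; apply: ler_sum => i _.
  rewrite -[leLHS]ger0_norm ?exprn_ge0// -sqrtr_sqr ler_sqrt ?psum_ge0//.
  by rewrite -exprM; exact: psum_coord.
- have r2 : 0 <= rho ^+ 2 by rewrite sqr_ge0.
  rewrite -[X in X * _](ger0_norm r2) -sqrtr_sqr -sqrtrM ?sqr_ge0//.
  rewrite ler_sqrt; first by rewrite -exprM; exact: h4.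
  by rewrite mulr_ge0 ?psum_ge0// sqr_ge0.
Qed.

Lemma l2_le_linf n (A : 'M[R]_n) (rho : R) : A^T = A -> 0 < rho ->
  (forall i, \sum_j `|A i j| <= rho) ->
  forall v, psum 2 (A *m v) <= rho ^+ 2 * psum 2 v.
Proof.
move=> AT rho0 h; have l0 := @linfnorm_ge0.
apply: (@symmetric_l2_le _ A rho n%:R (fun v => linfnorm v ^+ 2)) => // v.
- rewrite -[n in n%:R]card_ord mulr_natl -sumr_const; apply: ler_sum => i _.
  by rewrite ler_pXn2r ?nnegrE ?linfnorm_coord.
- rewrite -exprMn; apply: lerXn2r; rewrite ?nnegrE ?l0//.
    by rewrite mulr_ge0 ?l0// ltW.
  apply: linfnorm_le; first by rewrite mulr_ge0 ?l0// ltW.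
  move=> i; rewrite (le_trans (mulmx_norm _ _ (linfnorm_coord v)))//.
  by rewrite ler_wpM2r.
Qed.

Lemma row_sqr_le n (A : 'M[R]_n) (rho : R) : A^T = A ->
  (forall v, psum 2 (A *m v) <= rho ^+ 2 * psum 2 v) ->
  forall i, \sum_j A i j ^+ 2 <= rho ^+ 2.
Proof.
move=> AT h i; have := h (delta_mx i 0); rewrite !psum2E.
have -> : \sum_j (delta_mx i 0 : 'cV[R]_n) j 0 ^+ 2 = 1.
  rewrite (bigD1 i)//= big1 ?mxE ?eqxx ?expr1n ?addr0// => j ji.
  by rewrite mxE (negbTE ji) expr0n.
rewrite mulr1; apply: le_trans; apply: ler_sum => j _.
by rewrite -colE mxE -{2}AT mxE.
Qed.

Lemma alpha_ge n (A : 'M[R]_n) i : \sum_j A i j ^+ 2 <= alpha A.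
Proof. exact: (@le_bigmax _ _ _ 0 (fun i => \sum_j A i j ^+ 2)). Qed.

Lemma alpha_ge0 n (A : 'M[R]_n) : 0 <= alpha A.
Proof. exact: bigmax_ge_id. Qed.

End opnorm.

(** * Resampling one coordinate *)

Section resampling.
Context {d : measure_display} {T : measurableType d} {n : nat}.

Definition tset (x : n.-tuple T) (i : 'I_n) (z : T) : n.-tuple T :=
  [tuple if j == i then z else tnth x j | j < n].

Lemma tnth_tset x i z j : tnth (tset x i z) j = if j == i then z else tnth x j.
Proof. by rewrite tnth_mktuple. Qed.

Definition resample (i : 'I_n) (p : n.-tuple T * T) : n.-tuple T := tset p.1 i p.2.

Lemma measurable_resample i : measurable_fun setT (resample i).
Proof.
apply/measurable_fun_tnthP => j.
rewrite [X in measurable_fun _ X](_ : _ = fun p => if j == i then p.2 else tnth p.1 j).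
  case: (j == i); first exact: measurable_snd.
  exact: (measurableT_comp (measurable_tnth j) measurable_fst).
by apply/funext => p /=; rewrite tnth_tset.
Qed.

HB.instance Definition _ i :=
  isMeasurableFun.Build _ _ _ _ (resample i) (measurable_resample i).

Lemma measurable_box (B : 'I_n -> set T) : (forall i, measurable (B i)) ->
  measurable [set x : n.-tuple T | forall i, B i (tnth x i)].
Proof.
move=> mB; rewrite [X in measurable X](_ : _ =
    \big[setI/setT]_(i < n) ((@tnth n T ^~ i) @^-1` B i)).
  apply: bigsetI_measurable => i _.
  by rewrite -[X in measurable X]setTI; exact: measurable_tnth.
rewrite -bigcap_seq; apply/seteqP; split=> [x h i _|x h i]; first exact: h.
by apply: h => /=; rewrite mem_index_enum.
Qed.

Definition boxes : set (set (n.-tuple T)) :=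
  [set X | exists2 B : 'I_n -> set T, (forall i, measurable (B i)) &
    X = [set x | forall i, B i (tnth x i)]].

Lemma tuple_measurable_boxes (E : set (n.-tuple T)) : measurable E -> <<s boxes >> E.
Proof.
apply: smallest_sub; first exact: smallest_sigma_algebra.
rewrite -bigcup_seq => _ [i _ [B mB <-]]; rewrite setTI.
apply: sub_sigma_algebra; exists (fun j => if j == i then B else setT).
  by move=> j; case: (j == i).
apply/seteqP; split => x /=.
  by move=> Bx j; case: eqP => // ->.
by move=> /(_ i); rewrite eqxx.
Qed.

Context {R : realType} (mu : 'I_n -> probability T R).

(** An independent redraw of coordinate i leaves the product law unchanged; boxes form a generating
    pi-system on which this is a computation. As [prod_prob] splits off its first coordinate only,
    this is the way to Fubini in an arbitrary one. *)
Lemma prod_prob_resample i (E : set (n.-tuple T)) : measurable E ->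
  prod_prob mu E = distribution (prod_prob mu \x mu i)%E (resample i) E.
Proof.
move=> /tuple_measurable_boxes.
apply: (@g_sigma_algebra_measure_unique _ R _ boxes _ (fun=> setT) _ _
  (prod_prob mu) (distribution (prod_prob mu \x mu i)%E (resample i))).
- by move=> X [B mB ->]; exact: (measurable_box mB).
- by move=> _; exists (fun=> setT) => //; apply/seteqP; split => // x _ j.
- by rewrite bigcup_const.
- move=> X Y [B mB ->] [C mC ->]; exists (fun i => B i `&` C i).
    by move=> j; exact: measurableI.
  apply/seteqP; split => [x [h1 h2] j|x h]; first by split; [exact: h1|exact: h2].
  by split => j; case: (h j).
- move=> X [B mB ->]; apply: etrans (prod_prob_box mu mB) _.
  rewrite /distribution /pushforward /=.
  (* The constraint on coordinate i now falls on the fresh draw, so the old value is free. *)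
  pose B' j := if j == i then setT else B j.
  have mB' j : measurable (B' j) by rewrite /B'; case: (j == i).
  rewrite [X in (_ \x _)%E X](_ : _ = [set x | forall j, B' j (tnth x j)] `*` B i).
    rewrite product_measure1E//; last exact: (measurable_box mB').
    rewrite [X in (X * _)%E](prod_prob_box mu mB').
    rewrite [RHS]muleC (bigD1 i)//=; congr (_ * _)%E.
    rewrite [RHS](bigD1 i)//= {1}/B' eqxx [X in (X * _)%E]probability_setT mul1e.
    by apply: eq_bigr => j /negbTE ji; rewrite /B' ji.
  apply/seteqP; split => [[x z] /= h|[x z] /= [h1 h2] j].
    split => [j|]; last by have := h i; rewrite tnth_tset eqxx.
    by rewrite /B'; case: eqP => // /eqP/negbTE ji; have := h j; rewrite tnth_tset ji.
  rewrite tnth_tset; case: eqP => [->//|/eqP/negbTE ji].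
  by have := h1 j; rewrite /B' ji.
- by move=> _; rewrite (le_lt_trans (probability_le1 _ _))// ltry.
Qed.

Context (I : set T) (mI : measurable I) (muI : forall i, mu i I = 1%E).

Let Q : set (n.-tuple T) := [set x | forall i, I (tnth x i)].

Lemma measurable_cube : measurable Q. Proof. exact: (@measurable_box (fun=> I)). Qed.

Lemma prod_prob_cube : prod_prob mu Q = 1%E.
Proof. by apply: etrans (@prod_prob_box _ _ _ _ mu (fun=> I) _) _; rewrite ?big1. Qed.

Lemma Rintegral_resample_eq0 i (G : n.-tuple T -> R) : mbounded Q G ->
  (forall x, \int[mu i]_z (G (tset x i z))%:E = 0)%E ->
  \int[prod_prob mu]_x G x = 0.
Proof.
move=> bG G0; rewrite /Rintegral.
rewrite (@eq_measure_integral _ _ _ _ (distribution (prod_prob mu \x mu i)%E (resample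
  i))); last first.
  by move=> A mA _; exact: prod_prob_resample.
have mQI : measurable (Q `*` I) by apply: measurableX => //; exact: measurable_cube.
have QI1 : (prod_prob mu \x mu i)%E (Q `*` I) = 1%E.
  rewrite product_measure1E//; last exact: measurable_cube.
  by rewrite [X in (X * _)%E]prod_prob_cube mul1e; exact: muI.
have bGr : mbounded (Q `*` I) (G \o resample i).
  split; first by apply: measurableT_comp; [case: bG|exact: measurable_resample].
  have [_ [M GM]] := bG; exists M => -[x z] [/= Qx Iz]; apply: GM => j.
  by rewrite tnth_tset; case: eqP.
have iG := mbounded_integrable mQI QI1 bGr.
rewrite integral_distribution//; last by apply/measurable_EFinP; case: bG.
rewrite -integral12_prod_meas1//.
by rewrite (eq_integral (cst 0%E)) ?integral0// => x _; exact: G0.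
Qed.

End resampling.

(** * Conditional means of single spins under the model *)

Section conditional_mean.
Context {R : realType} {n : nat} (mu : 'I_n -> probability R R).
Context (A : 'M[R]_n) (c : 'cV[R]_n) (P : probability (n.-tuple R) R).
Hypothesis qm : quadratic_model mu A c P.

Definition ncube : set (n.-tuple R) := [set x | forall i, `[-1, 1]%classic (tnth x i)].

Let pi := prod_prob mu.
Let W x : R := expR (hamiltonian A c (spins x)) / partition_function mu A c.

Let muI i : mu i `[-1, 1]%classic = 1%E.
Proof. by have [bmu _ _] := qm; case: (bmu i). Qed.

Lemma measurable_ncube : measurable ncube.
Proof. by apply: measurable_cube; exact: measurable_itv. Qed.

Lemma prod_prob_ncube : pi ncube = 1%E.
Proof. by apply: prod_prob_cube => //; exact: measurable_itv. Qed.

Lemma mbounded_tnth i : mbounded ncube (fun x => tnth x i).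
Proof.
split; first exact: measurable_tnth.
by exists 1 => x /(_ i); rewrite /= in_itv /= ler_norml.
Qed.

Lemma hamiltonianE v : hamiltonian A c v =
  2^-1 * (\sum_j (\sum_k v k 0 * A k j) * v j 0) + \sum_j c j 0 * v j 0.
Proof.
rewrite /hamiltonian !mxE; congr (_ * _ + _).
  by apply: eq_bigr => j _; rewrite mxE; congr (_ * _); apply: eq_bigr => k _; rewrite mxE.
by apply: eq_bigr => j _; rewrite mxE.
Qed.

Lemma mbounded_spins i : mbounded ncube (fun x => spins x i 0).
Proof.
rewrite [X in mbounded _ X](_ : _ = fun x => tnth x i); first exact: mbounded_tnth.
by apply/funext => x; rewrite mxE.
Qed.

Lemma mbounded_density : mbounded ncube W.
Proof.
have bs := mbounded_spins.
rewrite [X in mbounded _ X](_ : _ = fun x => (partition_function mu A c)^-1 *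
  expR (2^-1 * (\sum_j (\sum_k spins x k 0 * A k j) * spins x j 0) +
    \sum_j c j 0 * spins x j 0)).
  apply/mboundedZ/mbounded_expR/mboundedD; last by apply: mbounded_sum => j; exact: mboundedZ.
  apply/mboundedZ/mbounded_sum => j; apply: mboundedM => //; apply: mbounded_sum => k.
  by apply: mboundedM => //; exact: mbounded_cst.
by apply/funext => x; rewrite /W hamiltonianE mulrC.
Qed.

Lemma model_ncube : P ncube = 1%E.
Proof.
have [_ _ PW] := qm.
by apply: (density_full measurable_ncube prod_prob_ncube mbounded_density).
Qed.

Lemma model_Rintegral f : mbounded ncube f -> \int[P]_x f x = \int[pi]_x (f x * W x).
Proof.
have [_ _ PW] := qm.
by apply: (Rintegral_density measurable_ncube prod_prob_ncube mbounded_density).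
Qed.

Lemma spins_tset (x : n.-tuple R) i z :
  spins (tset x i z) = spins (tset x i 0) + z *: delta_mx i 0.
Proof.
apply/matrixP => j k; rewrite !mxE !tnth_tset ord1 eqxx andbT.
by case: (j == i); rewrite ?mulr1 ?mulr0 ?add0r ?addr0.
Qed.

Lemma local_field_tset (x : n.-tuple R) i z :
  local_field A (spins (tset x i z)) i = local_field A (spins x) i.
Proof.
have [_ [_ A0] _] := qm; apply: eq_bigr => j _; rewrite !mxE tnth_tset.
by case: eqP => // ->; rewrite A0 !mul0r.
Qed.

Definition cmean i (x : n.-tuple R) : R :=
  tmean (mu i) (local_field A (spins x) i + c i 0).

Lemma measurable_tmean i : measurable_fun setT (tmean (mu i)).
Proof.
apply: continuous_measurable_fun => t.
apply/differentiable_continuous/derivable1_diffP.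
by case: (is_derive_tmean (muI i) t).
Qed.

Lemma mbounded_local_field i : mbounded ncube (fun x => local_field A (spins x) i).
Proof. by apply: mbounded_sum => j; apply/mboundedZ/mbounded_spins. Qed.

Lemma cmean_norm i x : `|cmean i x| <= 1.
Proof. exact: (tmean_norm (muI i)). Qed.

Lemma mbounded_cmean i : mbounded ncube (cmean i).
Proof.
split; last by exists 1 => x _; exact: cmean_norm.
apply: measurableT_comp; first exact: measurable_tmean.
by apply: measurable_funD => //; case: (mbounded_local_field i).
Qed.

Lemma cmean_tset i x z : cmean i (tset x i z) = cmean i x.
Proof. by rewrite /cmean local_field_tset. Qed.

Lemma mbounded_innovation i : mbounded ncube (fun x => tnth x i - cmean i x).
Proof. exact: mboundedB (mbounded_tnth i) (mbounded_cmean i). Qed.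

(** With the other spins frozen, the density in z is a constant times exp(t z) with t = m_i + c_i,
    so spin i follows [mu i] tilted by t, whose mean is [cmean]. Resampling integrates over this
    spin alone. *)
Lemma innovation_mean0 i (h : n.-tuple R -> R) : mbounded ncube h ->
  (forall x z, h (tset x i z) = h x) ->
  \int[P]_x (h x * (tnth x i - cmean i x)) = 0.
Proof.
move=> bh hi; have [_ cA _] := qm.
have bi := mbounded_innovation i.
rewrite (model_Rintegral (mboundedM bh bi)).
apply: (@Rintegral_resample_eq0 _ _ _ _ mu _ _ muI i) => //.
  exact: mboundedM (mboundedM bh bi) mbounded_density.
move=> x; set t := local_field A (spins x) i + c i 0.
pose K := h x * expR (hamiltonian A c (spins (tset x i 0))) / partition_function mu A c.
have b0 := mbounded_tilt 0 t; have b1 := mbounded_tilt 1 t.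
have mI : measurable (`[-1, 1]%classic : set R) by exact: measurable_itv.
have E z : h (tset x i z) * (tnth (tset x i z) i - cmean i (tset x i z)) * W (tset x i z) =
    K * (z ^+ 1 * expR (t * z) - tmean (mu i) t * (z ^+ 0 * expR (t * z))).
  rewrite hi tnth_tset eqxx cmean_tset /W spins_tset hamiltonian_shift//.
  rewrite local_field_tset -/t expRD /K /cmean -/t (mulrC z t); ring.
under eq_integral do rewrite E.
have bg := mboundedB b1 (mboundedZ (tmean (mu i) t) b0).
rewrite -[LHS]fineK; last first.
  apply: integrable_fin_num => //; exact: (mbounded_integrable mI (muI i) (mboundedZ K bg)).
rewrite -/(Rintegral _ _ _) (mbounded_RintegralZl mI (muI i) K bg).
rewrite (mbounded_RintegralB mI (muI i) b1 (mboundedZ _ b0)) (mbounded_RintegralZl mI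
  (muI i) _ b0).
rewrite -/(tilt _ 1 t) -/(tilt _ 0 t) /tmean mulfVK ?gt_eqF ?tilt0_gt0//.
by rewrite subrr mulr0.
Qed.

(** The measurable sets insensitive to coordinate i form a sigma-algebra that contains the
    generators. *)
Lemma sigma_others_tset i (B : set (n.-tuple R)) : sigma_others i B ->
  measurable B /\ forall x z, B (tset x i z) <-> B x.
Proof.
pose inv := [set B : set (n.-tuple R) | measurable B /\ forall x z, B (tset x i z) <-> B x].
suff H : sigma_others i `<=` inv by exact: H.
apply: smallest_sub.
  split.
  - by split.
  - move=> X [mX hX]; rewrite setTD; split; first exact: measurableC.
    by move=> x z /=; rewrite hX.
  - move=> F hF; split; first by apply: bigcup_measurable => k _; case: (hF k).
    by move=> x z; split => -[k _ Fk]; exists k => //; apply/(hF k).2; exact: Fk.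
move=> X [j /= ji [B' mB' <-]]; rewrite setTI; split.
  by rewrite -[X in measurable X]setTI; exact: measurable_tnth.
by move=> x z /=; rewrite tnth_tset (negbTE ji).
Qed.

Lemma set_integral_indic (B : set (n.-tuple R)) f : measurable B -> mbounded ncube f ->
  (\int[P]_(x in B) (f x)%:E = (\int[P]_x (\1_B x * f x))%:E)%E.
Proof.
move=> mB bf; have bB := mboundedM (mbounded_indic ncube mB) bf.
rewrite /Rintegral fineK; last first.
  by apply: integrable_fin_num => //; exact: (mbounded_integrable measurable_ncube
    model_ncube bB).
rewrite [LHS]integral_mkcond; apply: eq_integral => x _.
by rewrite patchE indicE; case: (x \in B); rewrite ?mul1r ?mul0r.
Qed.

(** Needed because [concentration_constant] speaks of versions of conditional expectations. The zero
    diagonal keeps spin i out of its own local field, and the averaging identity is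
    [innovation_mean0] for an indicator. *)
Lemma cmean_cond_expectation i :
  cond_expectation P (fun x => tnth x i) (sigma_others i) (cmean i).
Proof.
have [_ [_ A0] _] := qm.
split.
- move=> B mB.
  pose S := g_sigma_algebraType (\bigcup_(j in [set j | j != i])
        preimage_set_system setT (fun x : n.-tuple R => tnth x j) measurable).
  have mt j : j != i -> measurable_fun (setT : set S) (fun x : S => tnth (x : n.-tuple R) j).
    by move=> ji _ Y mY; apply: sub_sigma_algebra; exists j => //; exists Y.
  have ml : measurable_fun (setT : set S) (fun x : S => local_field A (spins (x :
    n.-tuple R)) i).
    apply: measurable_sum => j.
    have [->|ji] := eqVneq j i.
      rewrite [X in measurable_fun _ X](_ : _ = cst 0); first exact: measurable_cst.
      by apply/funext => x; rewrite A0 mul0r.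
    apply: measurable_funM => //.
    rewrite [X in measurable_fun _ X](_ : _ = fun x : S => tnth (x : n.-tuple R) j);
      first exact: mt.
    by apply/funext => x; rewrite mxE.
  have mc : measurable_fun (setT : set S) (cmean i : S -> R).
    by apply: measurableT_comp; [exact: measurable_tmean|exact: measurable_funD].
  by have := mc measurableT B mB; rewrite setTI.
- exact: (mbounded_integrable measurable_ncube model_ncube (mbounded_cmean i)).
move=> B /sigma_others_tset [mB hB].
have hI x z : (\1_B (tset x i z) : R) = \1_B x.
  by rewrite !indicE; congr (_%:R); congr (nat_of_bool _); apply/idP/idP; rewrite !inE => /hB.
have bx := mbounded_tnth i; have bc := mbounded_cmean i;
  have b1 : mbounded ncube (\1_B : _ -> R) := mbounded_indic ncube mB.
rewrite !set_integral_indic//; congr (_%:E).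
have := innovation_mean0 b1 hI.
under eq_Rintegral do rewrite mulrBr.
rewrite (mbounded_RintegralB measurable_ncube model_ncube (mboundedM b1 bx) (mboundedM b1 bc)).
by move/eqP; rewrite subr_eq0 => /eqP ->.
Qed.

End conditional_mean.

(** * Moments of the innovations *)

(** The summand of the fourth moment, with X = F, q = F - F_i, p = gamma_i, y = sigma_i - b_i and S
    = |gamma|^2. Only |p||q| and q^2, whose sums over i are controlled, remain. The cross term uses
    |p||X| <= (X^2 + S) / 2, and 59 = 3 + 2 * 28. *)
Lemma cubic_increment_le {R : realType} (X q p y S : R) : 0 <= S ->
  `|p| * `|q| <= 28 * S -> p ^+ 2 <= S -> `|y| <= 2 ->
  p * (X ^+ 3 - (X - q) ^+ 3) * y <=
  6 * X ^+ 2 * (`|p| * `|q|) + (3 * X ^+ 2 + 59 * S) * q ^+ 2.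
Proof.
move=> S0 pq pS y2.
have cube : `|X ^+ 3 - (X - q) ^+ 3| <=
    3 * `|X| ^+ 2 * `|q| + 3 * `|X| * `|q| ^+ 2 + `|q| ^+ 3.
  have -> : X ^+ 3 - (X - q) ^+ 3 = 3 * X ^+ 2 * q - 3 * X * q ^+ 2 + q ^+ 3 by ring.
  apply: le_trans (ler_normD _ _) _; rewrite [`|q ^+ 3|]normrX lerD2r.
  apply: le_trans (ler_normB _ _) _.
  by rewrite !(normrX, normrM) (ger0_norm (ler0n R 3)).
apply: le_trans (ler_norm _) _; rewrite 2!normrM.
rewrite -(real_normK (num_real X)) -(real_normK (num_real q)).
rewrite -(real_normK (num_real p)) in pS.
move: (normr_ge0 p) (normr_ge0 q) (normr_ge0 X) (normr_ge0 y) cube pq pS y2.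
move: `|_ - _| (normr_ge0 (X ^+ 3 - (X - q) ^+ 3)) `|p| `|q| `|X| `|y|.
move=> w w0 s t v u s0 t0 v0 u0 hw hst hs hu.
apply: (@le_trans _ _ (s * (3 * v ^+ 2 * t + 3 * v * t ^+ 2 + t ^+ 3) * 2)).
  by apply: ler_pM => //; [exact: mulr_ge0|exact: ler_wpM2l].
have h1 : s * v <= 2^-1 * (v ^+ 2 + S) by have := sqr_ge0 (s - v); lra.
have t2 := sqr_ge0 t.
have k1 := ler_wpM2r t2 h1; have k2 := ler_wpM2r t2 hst.
apply: (@le_trans _ _ (6 * v ^+ 2 * (s * t) + 6 * (s * v * t ^+ 2) + 2 * (s * t * t ^+ 2))).
  by rewrite le_eqVlt; apply/orP; left; apply/eqP; ring.
apply: (@le_trans _ _ (6 * v ^+ 2 * (s * t) + 6 * (2^-1 * (v ^+ 2 + S) * t ^+ 2) + 2 *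
  (28 * S * t ^+ 2))).
  by rewrite lerD ?lerD2l ?ler_wpM2l.
by rewrite le_eqVlt; apply/orP; left; apply/eqP; field.
Qed.

Section moments.
Context {R : realType} {n : nat} (mu : 'I_n -> probability R R).
Context (A : 'M[R]_n) (c : 'cV[R]_n) (P : probability (n.-tuple R) R).
Hypothesis qm : quadratic_model mu A c P.
Implicit Types (g : 'cV[R]_n) (x : n.-tuple R).
Hypothesis A_contr : forall v : 'cV[R]_n, psum 2 (A *m v) <= psum 2 v.

Let muI i : mu i `[-1, 1]%classic = 1%E.
Proof. by have [bmu _ _] := qm; case: (bmu i). Qed.

Let AT : A^T = A. Proof. by have [_ [-> _] _] := qm. Qed.

Let row_le1 i : \sum_j A i j ^+ 2 <= 1.
Proof.
have := @row_sqr_le _ _ A 1 AT _ i; rewrite expr1n; apply => v.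
by rewrite mul1r.
Qed.

Notation b := (cmean mu A c).

Definition innov (g : 'cV[R]_n) (x : n.-tuple R) : R :=
  \sum_j g j 0 * (tnth x j - b j x).

Lemma mbounded_innov g : mbounded ncube (innov g).
Proof. by apply: mbounded_sum => j; apply: mboundedZ; exact: (mbounded_innovation qm j). Qed.

Lemma local_field_tset0 (x : n.-tuple R) i j :
  local_field A (spins (tset x i 0)) j =
  local_field A (spins x) j - A j i * tnth x i.
Proof.
rewrite /local_field [in LHS](bigD1 i)//= [in RHS](bigD1 i)//= !mxE tnth_tset eqxx.
rewrite mulr0 add0r addrAC subrr add0r.
by apply: eq_bigr => k ki; rewrite !mxE tnth_tset (negbTE ki).
Qed.

(** Setting spin i to 0 changes F by a direct term sigma_i g_i, a linear response sigma_i (A k)_i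
    with k_j = psi_j'' g_j, and a remainder [E i]. Their squares sum to at most 1, 1 and 16 times
    |g|^2, and 54 = 3 * (1 + 1 + 16). *)
Lemma innov_shift_sum g x : ncube x ->
  \sum_i (innov g x - innov g (tset x i 0)) ^+ 2 <= 54 * psum 2 g.
Proof.
move=> xQ.
have x1 i : tnth x i ^+ 2 <= 1.
  have := xQ i; rewrite /= in_itv /= -ler_norml => h.
  have := @exprn_ile1 _ 2 _ (normr_ge0 (tnth x i)) h; rewrite real_normK//.
  exact: num_real.
pose V j := tvar (mu j) (local_field A (spins x) j + c j 0).
have V01 j : 0 <= V j <= 1.
  by rewrite /V tvar_ge0//= tvar_le1.
pose k : 'cV[R]_n := \col_j (V j * g j 0).
pose e i j := b j (tset x i 0) - b j x + V j * (A j i * tnth x i).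
have eb i j : `|e i j| <= 4 * A j i ^+ 2.
  have := tmean_taylor (muI j) (local_field A (spins x) j + c j 0) (- (A j i * tnth x i)).
  rewrite (addrAC (local_field A (spins x) j)) -local_field_tset0 -/(b j x) -/(b j
    (tset x i 0)) -/(V j).
  rewrite mulrN opprK -/(e i j) sqrrN exprMn => /le_trans; apply.
  rewrite mulrA -[leRHS]mulr1; apply: ler_wpM2l (x1 i).
  by rewrite mulr_ge0 ?sqr_ge0.
pose E i := \sum_j g j 0 * e i j.
have dE i : innov g x - innov g (tset x i 0) = tnth x i * g i 0 - tnth x i * (A *m k) i
  0 + E i.
  have -> : tnth x i * (A *m k) i 0 = \sum_j g j 0 * (V j * (A j i * tnth x i)).
    rewrite mxE mulr_sumr; apply: eq_bigr => j _; rewrite mxE -{1}AT mxE.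
    by move: (V j) => v; ring.
  have -> : tnth x i * g i 0 = \sum_j g j 0 * (tnth x j - tnth (tset x i 0) j).
    rewrite (bigD1 i)//= tnth_tset eqxx subr0 big1 ?addr0 1?mulrC// => j ji.
    by rewrite tnth_tset (negbTE ji) subrr mulr0.
  rewrite /innov /E -!sumrB -big_split /=; apply: eq_bigr => j _.
  rewrite /e; move: (V j) (b j x) (b j _) (tnth x j) (tnth _ j) => v b1 b2 t1 t2.
  by ring.
(* Cauchy-Schwarz with the split 4 A_ij^2 |g_j| = (4 A_ij)(A_ij |g_j|); the first factor sums to at
   most 16 over the row. *)
have E2 i : E i ^+ 2 <= 16 * \sum_j A i j ^+ 2 * g j 0 ^+ 2.
  apply: (@le_trans _ _ ((\sum_j (4 * A i j) * (A i j * `|g j 0|)) ^+ 2)).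
    rewrite -(real_normK (num_real (E i))) lerXn2r ?nnegrE//.
      by apply: sumr_ge0 => j _; rewrite mulrA mulr_ge0// -mulrA mulr_ge0// -expr2 sqr_ge0.
    rewrite (le_trans (ler_norm_sum _ _ _))// ler_sum// => j _.
    rewrite normrM mulrA mulrC -[4 * _ * _]mulrA -expr2 ler_wpM2r//.
    by rewrite (le_trans (eb i j))// -{1}AT mxE.
  apply: le_trans (cauchy_schwarz _ _) _.
  rewrite [X in X * _ <= _](_ : _ = 16 * \sum_j A i j ^+ 2); last first.
    by rewrite mulr_sumr; apply: eq_bigr => j _; ring.
  rewrite -mulrA ler_wpM2l// -[leRHS]mul1r.
  rewrite [X in _ * X <= _](_ : _ = \sum_j A i j ^+ 2 * g j 0 ^+ 2); last first.
    by apply: eq_bigr => j _; rewrite exprMn real_normK ?num_real.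
  by rewrite ler_wpM2r// sumr_ge0// => j _; rewrite mulr_ge0 ?sqr_ge0.
have sE : \sum_i E i ^+ 2 <= 16 * psum 2 g.
  apply: le_trans (ler_sum _ (fun i _ => E2 i)) _.
  rewrite -mulr_sumr ler_wpM2l// exchange_big psum2E /=; apply: ler_sum => j _.
  rewrite -mulr_suml -[leRHS]mul1r ler_wpM2r ?sqr_ge0//.
  by rewrite (le_trans _ (row_le1 j))//; apply: ler_sum => i _; rewrite -{1}AT mxE.
have sk : psum 2 (A *m k) <= psum 2 g.
  rewrite (le_trans (A_contr k))// !psum2E; apply: ler_sum => j _.
  rewrite mxE exprMn -[leRHS]mul1r ler_wpM2r ?sqr_ge0//.
  by have /andP[? ?] := V01 j; rewrite exprn_ile1.
apply: (@le_trans _ _ (\sum_i (3 * g i 0 ^+ 2 + 3 * (A *m k) i 0 ^+ 2 + 3 * E i ^+ 2))).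
  apply: ler_sum => i _; rewrite dE; move: (x1 i).
  move: (tnth x i) (g i 0) ((A *m k) i 0) (E i) => t p q r t1.
  apply: (@le_trans _ _ (3 * (t ^+ 2 * p ^+ 2) + 3 * (t ^+ 2 * q ^+ 2) + 3 * r ^+ 2)).
    have := sqr_ge0 (t * p + t * q); have := sqr_ge0 (t * p - r); have := sqr_ge0 (t * q + r).
    by rewrite -subr_ge0 => *; rewrite -subr_ge0; nra.
  by rewrite lerD2r lerD// ler_wpM2l// -[leRHS]mul1r ler_wpM2r ?sqr_ge0.
rewrite !big_split /= -!mulr_sumr -!psum2E.
by move: (psum 2 g) (psum 2 _) (\sum_i _) sE sk => p q r h1 h2; lra.
Qed.

Lemma tset_tset (x : n.-tuple R) i z w : tset (tset x i z) i w = tset x i w.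
Proof. by apply: eq_from_tnth => j; rewrite !tnth_tset; case: (j == i). Qed.

Lemma ncube_tset (x : n.-tuple R) i : ncube x -> ncube (tset x i (0 : R)).
Proof.
move=> xQ j; rewrite /= tnth_tset; case: eqP => [_|_]; last exact: xQ.
by rewrite in_itv /= lerN10 ler01.
Qed.

Lemma mbounded_innov_tset g i : mbounded ncube (fun x => innov g (tset x i 0)).
Proof.
have [mi [M iM]] := mbounded_innov g; split; last first.
  by exists M => x /ncube_tset xQ; exact: iM.
apply: measurableT_comp => //; apply/measurable_fun_tnthP => j.
rewrite [X in measurable_fun _ X](_ : _ = fun x => if j == i then 0 else tnth x j).
  by case: (j == i); [exact: measurable_cst|exact: measurable_tnth].
by apply/funext => x /=; rewrite tnth_tset.
Qed.

(* [innov g (tset x i 0) ^+ k] does not depend on the i-th coordinate, so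
   subtracting it is free by [innovation_mean0]. *)
Lemma innov_moment g k : \int[P]_x innov g x ^+ k.+1 =
  \int[P]_x \sum_i g i 0 * (innov g x ^+ k - innov g (tset x i 0) ^+ k)
                      * (tnth x i - b i x).
Proof.
have mQ := @measurable_ncube R n; have PQ := model_ncube qm.
pose F i (x : n.-tuple R) := g i 0 * innov g x ^+ k * (tnth x i - b i x).
pose G i (x : n.-tuple R) := g i 0 * innov g (tset x i 0) ^+ k * (tnth x i - b i x).
have bF i : mbounded ncube (F i) := mboundedM (mboundedZ _ (mboundedX k (mbounded_innov
  g))) (mbounded_innovation qm i).
have bZ i := mboundedZ (g i 0) (mboundedX k (mbounded_innov_tset g i)).
have bG i : mbounded ncube (G i) := mboundedM (bZ i) (mbounded_innovation qm i).
have G0 i : \int[P]_x G i x = 0.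
  by apply: (innovation_mean0 qm (bZ i)) => x z; rewrite tset_tset.
have FE : \int[P]_x innov g x ^+ k.+1 = \int[P]_x \sum_i F i x.
  apply: eq_Rintegral => x _; rewrite exprSr {2}/innov mulr_sumr.
  by apply: eq_bigr => i _; rewrite /F mulrA (mulrC (innov g x ^+ k)).
transitivity (\int[P]_x \sum_i (F i x - G i x)); last first.
  by apply: eq_Rintegral => x _; apply: eq_bigr => i _; rewrite /F /G -mulrBl -mulrBr.
rewrite FE; clear FE; clearbody F G.
rewrite (mbounded_Rintegral_sum mQ PQ _ bF) (mbounded_Rintegral_sum mQ PQ _ (fun i =>
  mboundedB (bF i) (bG i))).
by apply: eq_bigr => i _; rewrite (mbounded_RintegralB mQ PQ (bF i) (bG i)) (G0 i) subr0.
Qed.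

Lemma innovation_norm x i : ncube x -> `|tnth x i - b i x| <= 2.
Proof.
move=> xQ; have := xQ i; rewrite /= in_itv /= -ler_norml => h.
rewrite (le_trans (ler_normB _ _))// (_ : 2 = 1 + 1)%R//.
by apply: lerD => //; exact: (cmean_norm qm).
Qed.

(** By |p||q| <= (p^2 + q^2) / 2 the sum is at most (1 + 54) / 2 = 27.5 times |g|^2, rounded up to
    28. *)
Lemma innov_shift_prod g x : ncube x ->
  \sum_i `|g i 0| * `|innov g x - innov g (tset x i 0)| <= 28 * psum 2 g.
Proof.
move=> xQ; have := innov_shift_sum g xQ => h.
apply: (@le_trans _ _ (\sum_i (2^-1 * g i 0 ^+ 2 + 2^-1 * (innov g x - innov g (tset x
  i 0)) ^+ 2))).
  apply: ler_sum => i _; move: (g i 0) (innov g x - _) => p q.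
  rewrite -(real_normK (num_real p)) -(real_normK (num_real q)).
  by move: `|p| `|q| => s t; have := sqr_ge0 (s - t); nra.
rewrite big_split /= -!mulr_sumr -psum2E.
by move: (psum 2 g) (\sum_i _) (psum_ge0 2 g) h => p q p0 h; lra.
Qed.

Lemma innov_moment2 g : \int[P]_x innov g x ^+ 2 <= 56 * psum 2 g.
Proof.
have mQ := @measurable_ncube R n; have PQ := model_ncube qm.
rewrite innov_moment -(Rintegral_cstT P (56 * _)); apply: (mbounded_le_Rintegral mQ PQ).
- apply: mbounded_sum => i; apply: mboundedM (mbounded_innovation qm i).
  by apply: mboundedZ; apply: mboundedB; apply: mboundedX;
    [exact: mbounded_innov|exact: mbounded_innov_tset].
- exact: mbounded_cst.
move=> x xQ; rewrite (_ : 56 * psum 2 g = 28 * psum 2 g * 2); last by ring.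
apply: le_trans (ler_wpM2r _ (innov_shift_prod g xQ)) => //.
rewrite mulr_suml; apply: ler_sum => i _; apply: le_trans (ler_norm _) _.
have E (p q r y : R) : `|p * (q ^+ 1 - r ^+ 1) * y| = `|p| * `|q - r| * `|y|.
  by rewrite !normrM !expr1.
rewrite E; apply: ler_wpM2l (innovation_norm i xQ).
exact: mulr_ge0.
Qed.

Lemma innov_moment4 g : \int[P]_x innov g x ^+ 4 <= 148 ^+ 2 * psum 2 g ^+ 2.
Proof.
have mQ := @measurable_ncube R n; have PQ := model_ncube qm.
set S := psum 2 g; have S0 : 0 <= S by exact: psum_ge0.
(* 330 = 6 * 28 + 3 * 54 and 3186 = 59 * 54. With the second moment at most 56 S the total is 21666
   S^2, below 148^2 S^2 = 21904 S^2. *)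
apply: (@le_trans _ _ (330 * S * \int[P]_x innov g x ^+ 2 + 3186 * S ^+ 2)); last first.
  have := ler_wpM2l S0 (innov_moment2 g); rewrite -/S.
  by move: (\int[P]_x _) => m h; rewrite -!mulrA; have := sqr_ge0 S; lra.
rewrite innov_moment -(mbounded_RintegralZl mQ PQ); last exact/mboundedX/mbounded_innov.
rewrite -(Rintegral_cstT P (3186 * _)) -(mbounded_RintegralD mQ PQ); last exact: mbounded_cst.
  2: exact/mboundedZ/mboundedX/mbounded_innov.
apply: (mbounded_le_Rintegral mQ PQ).
- apply: mbounded_sum => i; apply: mboundedM (mbounded_innovation qm i).
  by apply: mboundedZ; apply: mboundedB; apply: mboundedX;
    [exact: mbounded_innov|exact: mbounded_innov_tset].
- by apply: mboundedD (mbounded_cst _ _); exact/mboundedZ/mboundedX/mbounded_innov.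
move=> x xQ; set X := innov g x.
pose d i := X - innov g (tset x i 0).
have hd : \sum_i d i ^+ 2 <= 54 * S := innov_shift_sum g xQ.
have hp : \sum_i `|g i 0| * `|d i| <= 28 * S := innov_shift_prod g xQ.
have pS i : `|g i 0| * `|d i| <= 28 * S.
  by apply: le_trans hp; rewrite (bigD1 i)//= lerDl sumr_ge0// => j _; rewrite mulr_ge0.
have gS i : g i 0 ^+ 2 <= S by rewrite -real_normK ?num_real//; exact: psum_coord.
apply: (@le_trans _ _ (\sum_i (6 * X ^+ 2 * (`|g i 0| * `|d i|) + (3 * X ^+ 2 + 59 * S)
  * d i ^+ 2))).
  apply: ler_sum => i _.
  have -> : innov g (tset x i 0) = X - d i by rewrite /d opprB addrC subrK.
  exact: cubic_increment_le S0 (pS i) (gS i) (innovation_norm i xQ).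
rewrite big_split /= -!mulr_sumr.
have h6 : 0 <= 6 * X ^+ 2 by rewrite mulr_ge0// sqr_ge0.
have h3 : 0 <= 3 * X ^+ 2 + 59 * S by rewrite addr_ge0// mulr_ge0// sqr_ge0.
apply: le_trans (lerD (ler_wpM2l h6 hp) (ler_wpM2l h3 hd)) _.
by clear; move: X S => X S; rewrite le_eqVlt; apply/orP; left; apply/eqP; ring.
Qed.

End moments.

(** * Subexponential tails *)

Section subexponential.
Context {R : realType}.

(** For y < 1 this is ln((1 + y) / (1 - y)) >= 2 y. The symmetrised difference g has derivative t
    (e^t - e^(-t)) >= 0. *)
Lemma expR_pade (y : R) : 0 <= y -> (1 - y) * expR (y *+ 2) <= 1 + y.
Proof.
move=> y0; pose g (t : R) := (1 + t) * expR (- t) - (1 - t) * expR t.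
have dg (t : R) : is_derive t 1 g (t * (expR t - expR (- t))).
  apply: is_derive_eq.
  by rewrite /GRing.scale /=; ring.
have [c /andP[c0 _] E] := mvt_between dg 0 y.
rewrite min_l// in c0.
have g0 : 0 <= g y.
  have -> : g y = g y - g 0 by rewrite /g oppr0 !addr0 subrr subr0.
  by rewrite E mulr_ge0 ?subr0// mulr_ge0// subr_ge0 ler_expR; lra.
have : 0 <= g y * expR y by rewrite mulr_ge0 ?expR_ge0.
rewrite /g mulrBl -!mulrA -!expRD addNr expR0 mulr1 subr_ge0.
by rewrite mulr2n.
Qed.

(** [expR_pade] at y = 1 / (2 k + 1), for which (1 + y) / (1 - y) = (k + 1) / k. The shift 1/2 is
    the one that Stirling's exponent needs. *)
Lemma ln_ratio_ge (k : nat) : (0 < k)%N ->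
  1 <= (k%:R + 2^-1) * (ln k.+1%:R - ln k%:R) :> R.
Proof.
move=> k0; have kp : 0 < k%:R :> R by rewrite ltr0n.
rewrite -ln_div ?posrE ?ltr0n//.
have p2 : 0 < k%:R + 2^-1 :> R by rewrite addr_gt0.
rewrite -ler_pdivrMl// mulr1 -[leLHS]expRK ler_ln ?posrE ?expR_gt0 ?divr_gt0 ?ltr0n//.
have := @expR_pade ((k%:R *+ 2 + 1)^-1); rewrite invr_ge0 => h.
have {}h := h (_ : 0 <= k%:R *+ 2 + 1).
rewrite ler_pdivlMr//.
have E : (k%:R + 2^-1)^-1 = (k%:R *+ 2 + 1)^-1 *+ 2 :> R.
  by field; rewrite !gt_eqF//; lra.
have q0 : 0 < k%:R *+ 2 + 1 :> R by lra.
rewrite E; have := h (ltW q0) => {}h.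
have := ler_wpM2r (ltW q0) h; set e := expR _.
have -> : (1 - (k%:R *+ 2 + 1)^-1) * e * (k%:R *+ 2 + 1) = 2 * (e * k%:R).
  by field; rewrite gt_eqF.
have -> : (1 + (k%:R *+ 2 + 1)^-1) * (k%:R *+ 2 + 1) = 2 * k.+1%:R :> R.
  by rewrite -natr1; field; rewrite gt_eqF.
by rewrite ler_pM2l.
Qed.

Lemma ln_fact_le (k : nat) : (0 < k)%N ->
  ln k`!%:R <= (k%:R + 2^-1) * ln k%:R - k%:R + 1 :> R.
Proof.
case: k => // k _; elim: k => [|k IH]; first by rewrite ln1 mulr0; lra.
rewrite factS natrM lnM ?posrE ?ltr0n ?fact_gt0//.
have := @ln_ratio_ge k.+1 isT; move: IH.
rewrite -[k.+2%:R]natr1.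
move: (ln k.+1`!%:R) (k.+1%:R : R) => f K; move: (ln K) (ln (K + 1)) => l1 l2 h1 h2.
lra.
Qed.

(** The exponent 3 collects 1 from Stirling's bound, s from ln(k + 1) <= ln(k + s) + 1, and s from
    replacing e^(-k) by e^(-(k + s)). *)
Lemma fact_powR_le (k : nat) (s : R) : (0 < k)%N -> 0 <= s <= 1 ->
  k`!%:R * k.+1%:R `^ s <=
  expR 3 * ((k%:R + s) `^ (k%:R + s + 2^-1) * expR (- (k%:R + s))).
Proof.
move=> k0 /andP[s0 s1].
have k1 : 1 <= k%:R :> R by rewrite ler1n.
have x0 : 0 < k%:R + s by rewrite ltr_pwDl// ltr0n.
have f0 : 0 < k`!%:R :> R by rewrite ltr0n fact_gt0.
rewrite -[k`!%:R]lnK ?posrE// /powR !gt_eqF ?ltr0n// -!expRD ler_expR.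
have lk : 0 <= ln k%:R :> R by rewrite ln_ge0.
have lkx : ln k%:R <= ln (k%:R + s) by rewrite ler_ln ?posrE ?ltr0n// lerDl.
have l1 : ln k.+1%:R <= ln (k%:R + s) + 1.
  have -> : ln (k%:R + s) + 1 = ln ((k%:R + s) * expR 1).
    by rewrite lnM ?posrE ?expR_gt0// expRK.
  rewrite ler_ln ?posrE ?ltr0n ?mulr_gt0 ?expR_gt0//.
  have e2 : 2 <= expR 1 :> R by have := expR_ge1Dx (1 : R); lra.
  rewrite -natr1; apply: (@le_trans _ _ ((k%:R + s) * 2)); last by rewrite ler_pM2l.
  lra.
have := ln_fact_le k0.
move: (ln k`!%:R) (ln k.+1%:R) (ln k%:R) (ln (k%:R + s)) lk lkx l1 => f p q t lk lkx l1 h.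
have h1 : s * p <= s * t + s by rewrite -[X in _ + X]mulr1 -mulrDr ler_wpM2l.
have h2 : (k%:R + 2^-1) * q <= (k%:R + 2^-1) * t by rewrite ler_wpM2l// addr_ge0.
lra.
Qed.

Lemma is_derive_pow (k : nat) (t : R) :
  is_derive t 1 (fun u : R => u ^+ k) (k%:R * t ^+ k.-1).
Proof.
elim: k => [|k IH]; first by rewrite mul0r; exact: is_derive_cst.
have -> : (fun u : R => u ^+ k.+1) = (id * (fun u : R => u ^+ k))%R.
  by apply/funext => u; rewrite exprS.
refine (is_derive_eq (is_deriveM (is_derive_id t 1) IH) _).
rewrite /GRing.scale /= -natr1 mulr1.
by case: k {IH} => [|k] /=; rewrite ?exprS; ring.
Qed.

Lemma is_derive_expRN (t : R) : is_derive t 1 (fun u : R => expR (- u)) (- expR (- t)).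
Proof. by apply: is_derive_eq; rewrite /GRing.scale /=; ring. Qed.

(* [exp_tail k t] is the integral of [u^(k-1) e^(-u) / (k-1)!] over [u >= t]. *)
Definition exp_tail (k : nat) (t : R) : R := expR (- t) * \sum_(i < k) (t ^+ i / i`!%:R).

Lemma is_derive_exp_tail (k : nat) (t : R) :
  is_derive t 1 (exp_tail k.+1) (- (expR (- t) * (t ^+ k / k`!%:R))).
Proof.
elim: k => [|k IH].
  have -> : exp_tail 1 = (fun u : R => expR (- u)).
    by apply/funext => u; rewrite /exp_tail big_ord_recl big_ord0 expr0 divr1 addr0 mulr1.
  apply: is_derive_eq; rewrite expr0 divr1 /GRing.scale /=; ring.
have -> : exp_tail k.+2 = (fun u : R => exp_tail k.+1 u + expR (- u) * (u ^+ k.+1 /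
  k.+1`!%:R)).
  by apply/funext => u; rewrite /exp_tail big_ord_recr /= mulrDr.
have dp := is_deriveZ (k.+1`!%:R^-1) (is_derive_pow k.+1 t).
have -> : (fun u : R => exp_tail k.+1 u + expR (- u) * (u ^+ k.+1 / k.+1`!%:R)) =
   (exp_tail k.+1 + (fun u : R => expR (- u)) * (k.+1`!%:R^-1 \*: (fun u : R => u ^+ k.+1)))%R.
  by apply/funext => u; rewrite [u ^+ _ / _]mulrC.
refine (is_derive_eq (is_deriveD IH (is_deriveM (is_derive_expRN t) dp)) _).
rewrite /GRing.scale /= factS natrM exprS /GRing.scale /=.
by field; rewrite ?(addrC 1) ?natr1 !pnatr_eq0 -?lt0n ?fact_gt0.
Qed.

Lemma exp_tail0 (k : nat) : exp_tail k.+1 0 = 1.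
Proof.
rewrite /exp_tail oppr0 expR0 mul1r big_ord_recl /= expr0 divr1 big1 ?addr0// => i _.
by rewrite expr0n mul0r.
Qed.

Lemma exp_tail_ge0 k (t : R) : 0 <= t -> 0 <= exp_tail k t.
Proof.
by move=> t0; rewrite mulr_ge0 ?expR_ge0// sumr_ge0// => i _; rewrite divr_ge0 ?exprn_ge0.
Qed.

(** On [j, j + 1] the weight e^(-(j + 1)) is at most e^(-u), so the left side is at most the
    integral of (k + 1) u^k e^(-u). The function h states this as monotonicity, without an
    integral. *)
Lemma power_increment_le (k j : nat) :
  (j.+1%:R ^+ k.+1 - j%:R ^+ k.+1) * expR (- j.+1%:R) <=
   k.+1`!%:R * (exp_tail k.+1 j%:R - exp_tail k.+1 j.+1%:R).
Proof.
pose h (t : R) := t ^+ k.+1 * expR (- j.+1%:R) + k.+1`!%:R * exp_tail k.+1 t.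
have dh (t : R) : is_derive t 1 h (k.+1%:R * t ^+ k * (expR (- j.+1%:R) - expR (- t))).
  have dp := is_deriveZ (expR (- j.+1%:R)) (is_derive_pow k.+1 t).
  have dt := is_deriveZ (k.+1`!%:R) (is_derive_exp_tail k t).
  have -> : h = (expR (- j.+1%:R) \*: (fun u : R => u ^+ k.+1) +
      k.+1`!%:R \*: exp_tail k.+1)%R.
    by apply/funext => u; rewrite /h mulrC.
  refine (is_derive_eq (is_deriveD dp dt) _).
  rewrite /GRing.scale /= factS natrM.
  by field; rewrite ?(addrC 1) ?natr1 !pnatr_eq0 -?lt0n ?fact_gt0.
have [c /andP[c1 c2] E] := mvt_between dh j%:R j.+1%:R.
have jj : j%:R <= j.+1%:R :> R by rewrite ler_nat.
rewrite min_l// in c1; rewrite max_r// in c2.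
have : h j.+1%:R - h j%:R <= 0.
  rewrite E mulr_le0_ge0 ?subr_ge0// mulr_ge0_le0//.
    by rewrite mulr_ge0// exprn_ge0// (le_trans _ c1).
  by rewrite subr_le0 ler_expR lerN2.
rewrite /h; move: (exp_tail k.+1 j.+1%:R) (exp_tail k.+1 j%:R) (expR _) (k.+1`!%:R) => a b e f.
by move: (j.+1%:R ^+ k.+1) (j%:R ^+ k.+1) => p q; lra.
Qed.

Lemma power_layers (k N : nat) (y : R) : 0 <= y <= N%:R ->
  y ^+ k.+1 <= \sum_(j < N) (j.+1%:R ^+ k.+1 - j%:R ^+ k.+1) * (j%:R < y)%R%:R.
Proof.
have inc j : 0 <= j.+1%:R ^+ k.+1 - j%:R ^+ k.+1 :> R.
  by rewrite subr_ge0 ler_pXn2r ?nnegrE// ler_nat.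
move=> /andP[y0]; elim: N => [yN|N IH yN].
  by rewrite big_ord0 (_ : y = 0) ?expr0n//; apply: le_anti; rewrite y0 yN.
have [yN'|Ny] := leP y N%:R.
  by rewrite big_ord_recr /= (le_trans (IH yN'))// lerDl mulr_ge0.
rewrite (eq_bigr (fun j : 'I_N.+1 => j.+1%:R ^+ k.+1 - j%:R ^+ k.+1)) => [|j _]; last first.
  by rewrite (le_lt_trans _ Ny) ?mulr1// ler_nat -ltnS.
rewrite -(big_mkord xpredT (fun j => j.+1%:R ^+ k.+1 - j%:R ^+ k.+1 : R)).
by rewrite telescope_sumr// expr0n subr0 ler_pXn2r ?nnegrE.
Qed.

Lemma powR_tangent (u s : R) : 0 <= u -> 0 <= s <= 1 -> u `^ s <= 1 - s + s * u.
Proof.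
move=> u0 /andP[s0 s1]; have [->|un0] := eqVneq u 0.
  rewrite mulr0 addr0; have [->|sn0] := eqVneq s 0; first by rewrite powRr0 subr0.
  by rewrite powR0// subr_ge0.
have up : 0 < u by rewrite lt_def un0.
set w := 1 - s + s * u.
have wp : 0 < w.
  have [s00|sn0] := eqVneq s 0; first by rewrite /w s00; lra.
  by rewrite /w ltr_wpDl ?subr_ge0// mulr_gt0// lt_def sn0.
have lnle (z : R) : 0 < z -> ln z <= z - 1.
  by move=> z0; have := @le_ln1Dx R (z - 1); rewrite subrKC; apply; lra.
have a1 := lnle _ (divr_gt0 up wp); have a2 := lnle _ (divr_gt0 ltr01 wp).
rewrite /powR (negbTE un0) -[leRHS]lnK ?posrE// ler_expR.
rewrite ln_div ?posrE// in a1; rewrite ln_div ?posrE// ln1 in a2.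
have h1 := ler_wpM2l s0 a1.
have h2 := ler_wpM2l (_ : 0 <= 1 - s) a2; rewrite subr_ge0 in h2; have {}h2 := h2 s1.
(* Weighted arithmetic-geometric mean: ln z <= z - 1 at u / w and 1 / w, with weights s and 1 - s,
   and w chosen so that the right sides cancel. *)
have E : s * (u / w - 1) + (1 - s) * (1 / w - 1) = 0.
  by rewrite /w; field; rewrite gt_eqF.
lra.
Qed.

Context {d : measure_display} {T : measurableType d} (P : probability T R).
Context (Q : set T) (mQ : measurable Q) (PQ : P Q = 1%E).
Context (Y : T -> R) (bY : mbounded Q Y) (Y0 : forall x, 0 <= Y x).
Hypothesis tail : forall t, 0 < t -> (P [set x | (t < Y x)%R] <= (2 * expR (- t))%:E)%E.

(** Over unit layers, the tail bounds 2 e^(-j) times the increments of the power telescope through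
    [exp_tail]. The factor e pays for passing from e^(-j) to e^(-(j + 1)). *)
Lemma subexp_moment (k : nat) : \int[P]_x Y x ^+ k <= 2 * expR 1 * k`!%:R.
Proof.
case: k => [|k].
  have -> : \int[P]_x Y x ^+ 0 = 1 by exact: Rintegral_cstT.
  rewrite fact0 mulr1; have := expR_ge1Dx (1 : R); lra.
have [mY [M YM]] := bY.
pose N := Num.bound M.
have mj j : measurable [set x | j%:R < Y x].
  by have := mY measurableT _ (measurable_itv `]j%:R, +oo[); rewrite setTI; congr measurable;
    apply/seteqP; split => x /=; rewrite in_itv /= andbT.
pose w j : R := j.+1%:R ^+ k.+1 - j%:R ^+ k.+1.
have w0 j : 0 <= w j by rewrite subr_ge0 ler_pXn2r ?nnegrE// ler_nat.
have bI j : mbounded Q (fun x => w j * \1_[set x | j%:R < Y x] x)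
  by apply/mboundedZ/mbounded_indic.
apply: (@le_trans _ _ (\int[P]_x \sum_(j < N) w j * \1_[set x | j%:R < Y x] x)).
  apply: (mbounded_le_Rintegral mQ PQ); [exact: mboundedX|exact: mbounded_sum|].
  move=> x Qx; apply: (@le_trans _ _ (\sum_(j < N) w j * (j%:R < Y x)%R%:R)); last first.
    apply: ler_sum => j _; rewrite indicE; apply: ler_wpM2l => //.
    by rewrite ler_nat; case: (boolP (j%:R < Y x)) => // h; rewrite mem_set.
  apply: power_layers; rewrite Y0/=.
  have YMx := YM _ Qx; rewrite ger0_norm// in YMx.
  apply: le_trans YMx (ltW _); apply: archi_boundP.
  by rewrite (le_trans _ (YM _ Qx)).
rewrite (mbounded_Rintegral_sum mQ PQ)//.
apply: (@le_trans _ _ (\sum_(j < N) 2 * expR 1 * (k.+1`!%:R * (exp_tail k.+1 j%:R -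
  exp_tail k.+1 j.+1%:R)))).
  apply: ler_sum => j _; rewrite (mbounded_RintegralZl mQ PQ _ (mbounded_indic _ (mj
    j))) (Rintegral_indicT P (mj j)).
  have Pj : fine (P [set x | j%:R < Y x]) <= 2 * expR (- j%:R).
    (* [tail] is given for t > 0 only; at level 0 a probability is at most 1 <= 2. *)
    have [j0|j0] := posnP j.
      rewrite j0 oppr0 expR0 mulr1 (@le_trans _ _ 1)//; last lra.
      by rewrite -lee_fin fineK ?fin_num_measure// probability_le1.
    by rewrite -lee_fin fineK ?fin_num_measure//; apply: tail; rewrite ltr0n.
  apply: le_trans (ler_wpM2l (w0 j) Pj) _.
  apply: (@le_trans _ _ (2 * expR 1 * (w j * expR (- j.+1%:R)))); last first.
    by rewrite ler_wpM2l ?mulr_ge0 ?expR_ge0// power_increment_le.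
  rewrite -[j.+1%:R]natr1 opprD expRD; move: (expR (- j%:R)) (w j) => e v.
  have := expRN (1 : R) => ->.
  by rewrite le_eqVlt; apply/orP; left; apply/eqP; field; rewrite gt_eqF ?expR_gt0.
rewrite -!mulr_sumr -(big_mkord xpredT (fun j => exp_tail k.+1 j%:R - exp_tail k.+1
  j.+1%:R : R)).
rewrite ler_wpM2l ?mulr_ge0 ?expR_ge0// -[leRHS]mulr1 ler_wpM2l//.
under eq_bigr do rewrite -opprB.
by rewrite sumrN telescope_sumr// opprB exp_tail0 lerBlDr lerDl exp_tail_ge0.
Qed.

Lemma mbounded_powR (x : R) : 0 <= x -> mbounded Q (fun y => Y y `^ x).
Proof.
move=> x0; have [mY [M YM]] := bY; split.
  exact: measurableT_comp (measurable_powR x) mY.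
exists (M `^ x) => y Qy; rewrite ger0_norm ?powR_ge0//.
have := YM _ Qy; rewrite ger0_norm// => h.
by rewrite ge0_ler_powR ?nnegrE// (le_trans _ h).
Qed.

Lemma subexp_powR_moment (x : R) : 1 <= x ->
  \int[P]_y Y y `^ x <= 2 * expR 4 * (x `^ (x + 2^-1) * expR (- x)).
Proof.
move=> x1; have x0 : 0 <= x by exact: le_trans x1.
pose k := Num.truncn x; pose s := x - k%:R.
have /andP[kx xk] : k%:R <= x < k.+1%:R by apply: truncn_itv.
have k0 : (0 < k)%N by rewrite truncn_gt0.
have s01 : 0 <= s <= 1 by rewrite /s -natr1 in xk *; apply/andP; split; lra.
have xE : x = k%:R + s by rewrite /s addrC subrK.
(* Y^s is bounded by its tangent at L = k + 1. Since (k + 1)! / L = k!, the bounds for the moments k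
   and k + 1 merge into the single term k! L^s. *)
pose L : R := k.+1%:R; have L0 : 0 < L by rewrite ltr0n.
have /andP[s0 s1] := s01.
have bk l := mboundedX l bY.
pose F y := L `^ s * (1 - s) * Y y ^+ k + L `^ s * s / L * Y y ^+ k.+1.
have b1 := mboundedZ (L `^ s * (1 - s)) (bk k); have b2 := mboundedZ (L `^ s * s / L)
  (bk k.+1).
apply: (@le_trans _ _ (\int[P]_y F y)).
  apply: (mbounded_le_Rintegral mQ PQ); [exact: mbounded_powR|exact: mboundedD|].
  move=> y _; rewrite /F xE powRD; last by rewrite -xE gt_eqF// (lt_le_trans ltr01).
  rewrite powR_mulrn//.
  have : Y y `^ s <= L `^ s * (1 - s + s * (Y y / L)).
    have yL : 0 <= Y y / L by rewrite divr_ge0// ltW.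
    have yE : Y y `^ s = L `^ s * (Y y / L) `^ s.
      by rewrite -(@powRM R _ _ _ (ltW L0) yL) mulrC (mulfVK (lt0r_neq0 L0)).
    by rewrite yE ler_wpM2l ?powR_ge0//; exact: powR_tangent.
  move=> /(ler_wpM2l (exprn_ge0 k (Y0 y))) /le_trans; apply.
  by rewrite le_eqVlt; apply/orP; left; apply/eqP; rewrite exprS; field; rewrite gt_eqF.
rewrite (mbounded_RintegralD mQ PQ b1 b2) (mbounded_RintegralZl mQ PQ _ (bk k))
  (mbounded_RintegralZl mQ PQ _ (bk k.+1)).
apply: (@le_trans _ _ (2 * expR 1 * (k`!%:R * L `^ s))).
  apply: le_trans (lerD (ler_wpM2l _ (subexp_moment k)) (ler_wpM2l _ (subexp_moment k.+1))) _.
  - by rewrite mulr_ge0 ?powR_ge0// subr_ge0.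
  - by rewrite divr_ge0 ?mulr_ge0 ?powR_ge0// ltW.
  rewrite factS natrM -/L le_eqVlt; apply/orP; left; apply/eqP.
  by field; rewrite gt_eqF.
apply: le_trans (ler_wpM2l _ (fact_powR_le k0 s01)) _; first by rewrite mulr_ge0 ?expR_ge0.
have e4 : expR 4 = expR 1 * expR 3 :> R by rewrite -expRD; congr expR; ring.
by rewrite -xE e4 le_eqVlt; apply/orP; left; apply/eqP; ring.
Qed.

End subexponential.

(** * The local fields *)

Section fixed_point.
Context {R : realType} {n : nat} (mu : 'I_n -> probability R R).
Context (A : 'M[R]_n) (c : 'cV[R]_n) (P : probability (n.-tuple R) R) (u : 'cV[R]_n).
Hypothesis qm : quadratic_model mu A c P.
Hypothesis opt : mean_field_optimizer mu A c u.

Definition row_col (B : 'M[R]_n) i : 'cV[R]_n := \col_j B i j.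

Lemma psum_row_col i : psum 2 (row_col A i) <= alpha A.
Proof.
rewrite psum2E (le_trans _ (alpha_ge A i))//.
by apply: ler_sum => j _; rewrite mxE.
Qed.

Definition field_gap (x : n.-tuple R) : 'cV[R]_n :=
  \col_i (local_field A (spins x) i - local_field A u i).

Definition mean_gap (x : n.-tuple R) : 'cV[R]_n :=
  \col_i (cmean mu A c i x - u i 0).

Lemma field_gapE x i : field_gap x i 0 =
  innov mu A c (row_col A i) x + (A *m mean_gap x) i 0.
Proof.
rewrite !mxE /innov /local_field -sumrB -big_split /=; apply: eq_bigr => j _.
by rewrite !mxE; move: (cmean _ _ _ j x) => m; ring.
Qed.

Lemma mean_gap_le x i : `|mean_gap x i 0| <= `|field_gap x i 0|.
Proof.
have [bmu cA _] := qm; have [muQ _ _ _] := bmu i.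
rewrite !mxE (optimizer_tmean i bmu cA opt) /cmean.
apply: le_trans (tmean_lip muQ _ _) _.
by rewrite opprD addrACA subrr addr0.
Qed.

Lemma mbounded_field_gap i : mbounded ncube (fun x => field_gap x i 0).
Proof.
rewrite [X in mbounded _ X](_ : _ = fun x => local_field A (spins x) i - local_field A u i).
  by apply: mboundedB; [exact: mbounded_local_field|exact: mbounded_cst].
by apply/funext => x; rewrite mxE.
Qed.

(* Minkowski's inequality for [field_gap = innov + A mean_gap], in the form
   that convexity of [|.|^k] gives directly. *)
Lemma field_gap_le_contr (rho : R) k x : 0 < rho < 1 ->
  (forall y z : R, `|y + z| ^+ k.+1 <=
    (1 - rho) * (`|y| / (1 - rho)) ^+ k.+1 + rho * (`|z| / rho) ^+ k.+1) ->
  (forall v : 'cV[R]_n, psum k.+1 (A *m v) <= rho ^+ k.+1 * psum k.+1 v) ->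
  psum k.+1 (field_gap x) <=
  \sum_i (`|innov mu A c (row_col A i) x| / (1 - rho)) ^+ k.+1.
Proof.
move=> /andP[r0 r1] conv contr.
have q0 : 0 < 1 - rho by rewrite subr_gt0.
set W := psum _ _; set X := \sum_i _.
suff h : W <= (1 - rho) * X + rho * W.
  by rewrite -(ler_pM2l q0) mulrBl mul1r lerBlDr.
apply: (@le_trans _ _ (\sum_i ((1 - rho) * (`|innov mu A c (row_col A i) x| / (1 -
  rho)) ^+ k.+1 +
   rho * (`|(A *m mean_gap x) i 0| / rho) ^+ k.+1))).
  by apply: ler_sum => i _; rewrite field_gapE; exact: conv.
rewrite big_split /= -!mulr_sumr lerD2l ler_pM2l//.
have -> : \sum_i (`|(A *m mean_gap x) i 0| / rho) ^+ k.+1 = psum k.+1 (A *m mean_gap x)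
  / rho ^+ k.+1.
  by rewrite /psum mulr_suml; apply: eq_bigr => i _; rewrite expr_div_n.
rewrite ler_pdivrMr ?exprn_gt0// mulrC (le_trans (contr _))// ler_pM2l ?exprn_gt0//.
by apply: ler_sum => i _; rewrite lerXn2r ?nnegrE// mean_gap_le.
Qed.

End fixed_point.

(** * Convexity of powers *)

Section convexity.
Context {R : realType}.

Lemma convex_sqr (rho y z : R) : 0 < rho < 1 ->
  `|y + z| ^+ 2 <= (1 - rho) * (`|y| / (1 - rho)) ^+ 2 + rho * (`|z| / rho) ^+ 2.
Proof.
move=> /andP[r0 r1]; have q0 : 0 < 1 - rho by rewrite subr_gt0.
rewrite !expr_div_n !real_normK ?num_real// -subr_ge0.
have -> : (1 - rho) * (y ^+ 2 / (1 - rho) ^+ 2) + rho * (z ^+ 2 / rho ^+ 2) - (y + z) ^+ 2 =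
   (rho * y - (1 - rho) * z) ^+ 2 / (rho * (1 - rho)).
  by field; rewrite !gt_eqF.
by rewrite divr_ge0 ?sqr_ge0// mulr_ge0// ltW.
Qed.

Lemma convex_expr4 (rho y z : R) : 0 < rho < 1 ->
  `|y + z| ^+ 4 <= (1 - rho) * (`|y| / (1 - rho)) ^+ 4 + rho * (`|z| / rho) ^+ 4.
Proof.
move=> r01; have /andP[r0 r1] := r01; have q0 : 0 < 1 - rho by rewrite subr_gt0.
have h := convex_sqr y z r01.
set p := (1 - rho) * (`|y| / (1 - rho)) ^+ 2 in h; set q := rho * (`|z| / rho) ^+ 2 in h.
have p0 : 0 <= p by rewrite mulr_ge0 ?sqr_ge0 ?ltW.
have q1 : 0 <= q by rewrite mulr_ge0 ?sqr_ge0 ?ltW.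
rewrite [leLHS](exprM _ 2 2).
apply: (@le_trans _ _ (`|p + q| ^+ 2)).
  by rewrite lerXn2r ?nnegrE ?exprn_ge0// (le_trans h)// ler_norm.
apply: le_trans (convex_sqr p q r01) _.
rewrite (ger0_norm p0) (ger0_norm q1) /p /q le_eqVlt; apply/orP; left; apply/eqP.
by field; rewrite !gt_eqF.
Qed.

(** This is [powR_tangent] with exponent 1/r at u = (t / s)^r, multiplied by r s^r. *)
Lemma powR_tangent_le (r s t : R) : 1 < r -> 0 <= s -> 0 <= t ->
  s `^ r + r * s `^ (r - 1) * (t - s) <= t `^ r.
Proof.
move=> r1 s0 t0; have r0 : 0 < r by exact: lt_trans r1.
have rn1 : r - 1 != 0 by rewrite subr_eq0 gt_eqF.
have [->|sn0] := eqVneq s 0.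
  by rewrite (powR0 (lt0r_neq0 r0)) (powR0 rn1) mulr0 mul0r addr0 powR_ge0.
have sp : 0 < s by rewrite lt_def sn0.
have ts : 0 <= t / s by rewrite divr_ge0.
have r01 : 0 <= r^-1 <= 1 by rewrite invr_ge0 ltW//= invf_le1// ltW.
have := powR_tangent (powR_ge0 (t / s) r) r01.
rewrite -powRrM mulfV ?gt_eqF// powRr1// => h.
have tE : t `^ r = s `^ r * (t / s) `^ r.
  by rewrite -powRM// mulrC mulfVK.
have sE : s `^ (r - 1) * s = s `^ r by rewrite mulrC mulr_powRB1.
have k := ler_wpM2l (mulr_ge0 (ltW r0) (powR_ge0 s r)) h.
rewrite tE; move: k; set v := (t / s) `^ r.
have -> : r * s `^ r * (1 - r^-1 + r^-1 * v) = (r - 1) * s `^ r + s `^ r * v.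
  by field; rewrite gt_eqF.
have -> : r * s `^ r * (t / s) = r * s `^ (r - 1) * t.
  by rewrite -sE; field.
rewrite mulrBr -[r * s `^ (r - 1) * s]mulrA sE.
by move: (s `^ r) (s `^ (r - 1)) => a b; lra.
Qed.

Lemma powR_jensen n (r rho s y0 : R) (a y : 'I_n -> R) : 1 < r -> rho <= 1 ->
  0 <= s -> 0 <= y0 -> (forall j, 0 <= a j) -> (forall j, 0 <= y j) ->
  \sum_j a j <= rho -> s <= (1 - rho) * y0 + \sum_j a j * y j ->
  s `^ r <= (1 - rho) * y0 `^ r + \sum_j a j * y j `^ r.
Proof.
move=> r1 rho1 s0 y00 a0 yy0 arho sle.
have q0 : 0 <= 1 - rho by rewrite subr_ge0.
have h0 := ler_wpM2l q0 (powR_tangent_le r1 s0 y00).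
have h1 : \sum_j a j * (s `^ r + r * s `^ (r - 1) * (y j - s)) <= \sum_j a j * y j `^ r.
  by apply: ler_sum => j _; rewrite ler_wpM2l// powR_tangent_le.
apply: le_trans (lerD h0 h1).
have -> : \sum_j a j * (s `^ r + r * s `^ (r - 1) * (y j - s)) =
    (s `^ r - r * s `^ (r - 1) * s) * (\sum_j a j) + r * s `^ (r - 1) * (\sum_j a j * y j).
  by rewrite !mulr_sumr -big_split /=; apply: eq_bigr => j _; ring.
have sE : s `^ (r - 1) * s = s `^ r by rewrite mulrC mulr_powRB1// (lt_trans _ r1).
have b0 : 0 <= r * s `^ (r - 1) by rewrite mulr_ge0 ?powR_ge0// (le_trans _ (ltW r1)).
have k1 := ler_wpM2l b0 sle.
(* The weights may sum to less than 1; the tangent at s turns the missing mass into this nonnegative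
   surplus. *)
have k2 : 0 <= (r - 1) * s `^ r * (rho - \sum_j a j).
  by rewrite !mulr_ge0 ?powR_ge0 ?subr_ge0// ltW.
rewrite -sE in k2 *; move: k1 k2; clear.
move: (\sum_j a j * y j) (\sum_j a j) (s `^ (r - 1)) => p q v k1 k2.
lra.
Qed.

End convexity.

(** * The three moment bounds *)

Section conclusions.
Context {R : realType} {n : nat} (mu : 'I_n -> probability R R).
Context (A : 'M[R]_n) (c : 'cV[R]_n) (P : probability (n.-tuple R) R) (u : 'cV[R]_n).
Hypothesis qm : quadratic_model mu A c P.
Hypothesis opt : mean_field_optimizer mu A c u.
Context (rho : R) (rho_gt0 : 0 < rho) (rho_lt1 : rho < 1).

Let rho01 : 0 < rho < 1. Proof. by rewrite rho_gt0. Qed.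
Let q0 : 0 < 1 - rho. Proof. by rewrite subr_gt0. Qed.
Let AT : A^T = A. Proof. by have [_ [-> _] _] := qm. Qed.
Let mQ := @measurable_ncube R n.
Let PQ := model_ncube qm.

Notation X i := (innov mu A c (row_col A i)).

Lemma contr_le1 : (forall v : 'cV[R]_n, psum 2 (A *m v) <= rho ^+ 2 * psum 2 v) ->
  forall v : 'cV[R]_n, psum 2 (A *m v) <= psum 2 v.
Proof.
move=> h v; rewrite (le_trans (h v))// -[leRHS]mul1r ler_wpM2r ?psum_ge0//.
by rewrite exprn_ile1// ltW.
Qed.

Lemma expectation_gap_le (f : R -> R) (g : R -> R) (M : R) :
  (forall i, mbounded ncube (fun x => f (field_gap A u x i 0))) ->
  (forall i, mbounded ncube (fun x => g (X i x))) ->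
  (forall x, \sum_i f (field_gap A u x i 0) <= \sum_i g (X i x)) ->
  (forall i, \int[P]_x g (X i x) <= M) ->
  ('E_P[fun x => (\sum_(i < n) f (local_field A (spins x) i - local_field A u i))%R] <=
     (n%:R * M)%:E)%E.
Proof.
move=> bf bg fg gM.
have -> : (fun x => \sum_(i < n) f (local_field A (spins x) i - local_field A u i)) =
    (fun x => \sum_(i < n) f (field_gap A u x i 0)).
  by apply/funext => x; apply: eq_bigr => i _; rewrite mxE.
rewrite (mbounded_expectation mQ PQ (mbounded_sum _ bf)) lee_fin.
apply: (@le_trans _ _ (\int[P]_x \sum_(i < n) g (X i x))).
  by apply: (mbounded_le_Rintegral mQ PQ (mbounded_sum _ bf) (mbounded_sum _ bg)) => x
    _; exact: fg.
rewrite (mbounded_Rintegral_sum mQ PQ _ bg) -[n in n%:R]card_ord mulr_natl -sumr_const.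
exact: ler_sum.
Qed.

Lemma gap_moment2 : (forall v : 'cV[R]_n, psum 2 (A *m v) <= rho ^+ 2 * psum 2 v) ->
  ('E_P[fun x => (\sum_(i < n) (local_field A (spins x) i - local_field A u i) ^+ 2)%R] <=
     (56 / (1 - rho) ^+ 2 * (n%:R * alpha A))%:E)%E.
Proof.
move=> contr; rewrite mulrCA.
apply: (@expectation_gap_le (fun t => t ^+ 2) (fun t => (t / (1 - rho)) ^+ 2)).
- by move=> i; exact/mboundedX/mbounded_field_gap.
- move=> i; apply: mboundedX; apply: mboundedM; last exact: mbounded_cst.
  exact: (mbounded_innov qm).
- move=> x; have := field_gap_le_contr qm opt (k := 1) x rho01 (fun y z => convex_sqr y
  z rho01) contr.
  rewrite psum2E => /le_trans; apply; apply: ler_sum => i _.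
  by rewrite !expr_div_n real_normK// num_real.
- move=> i; have bi := mboundedX 2 (mbounded_innov qm (row_col A i)).
  have -> : \int[P]_x (X i x / (1 - rho)) ^+ 2 = \int[P]_x ((1 - rho) ^- 2 * X i x ^+ 2).
    by apply: eq_Rintegral => x _; rewrite expr_div_n mulrC.
  rewrite (mbounded_RintegralZl mQ PQ _ bi) [leRHS]mulrAC [leRHS]mulrC.
  apply: ler_wpM2l; first by rewrite invr_ge0 exprn_ge0// ltW.
  apply: le_trans (innov_moment2 qm (contr_le1 contr) _) _.
  have h56 : 0 <= 56 :> R by exact: ler0n.
  exact: (ler_wpM2l h56 (psum_row_col A i)).
Qed.

Lemma gap_moment4 : (forall v : 'cV[R]_n, psum 2 (A *m v) <= rho ^+ 2 * psum 2 v) ->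
  (forall v : 'cV[R]_n, psum 4 (A *m v) <= rho ^+ 4 * psum 4 v) ->
  ('E_P[fun x => (\sum_(i < n) (local_field A (spins x) i - local_field A u i) ^+ 4)%R] <=
     (148 ^+ 2 / (1 - rho) ^+ 4 * (n%:R * alpha A ^+ 2))%:E)%E.
Proof.
move=> contr contr4; rewrite mulrCA.
have even4 (t : R) : `|t| ^+ 4 = t ^+ 4.
  by rewrite (exprM _ 2 2) real_normK ?num_real// -exprM.
apply: (@expectation_gap_le (fun t => t ^+ 4) (fun t => (t / (1 - rho)) ^+ 4)).
- by move=> i; exact/mboundedX/mbounded_field_gap.
- move=> i; apply: mboundedX; apply: mboundedM; last exact: mbounded_cst.
  exact: (mbounded_innov qm).
- move=> x; have := field_gap_le_contr qm opt (k := 3) x rho01 (fun y z => convex_expr4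
  y z rho01) contr4.
  rewrite /psum (eq_bigr (fun i => field_gap A u x i 0 ^+ 4)) => [|i _]; last exact: even4.
  move=> /le_trans; apply; apply: ler_sum => i _.
  by rewrite !expr_div_n even4.
- move=> i; have bi := mboundedX 4 (mbounded_innov qm (row_col A i)).
  have -> : \int[P]_x (X i x / (1 - rho)) ^+ 4 = \int[P]_x ((1 - rho) ^- 4 * X i x ^+ 4).
    by apply: eq_Rintegral => x _; rewrite expr_div_n mulrC.
  rewrite (mbounded_RintegralZl mQ PQ _ bi) [leRHS]mulrAC [leRHS]mulrC.
  apply: ler_wpM2l; first by rewrite invr_ge0 exprn_ge0// ltW.
  apply: le_trans (innov_moment4 qm (contr_le1 contr) _) _.
  have h : 0 <= 148 ^+ 2 :> R by exact: sqr_ge0.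
  apply: (ler_wpM2l h); apply: lerXn2r; last exact: psum_row_col.
    by rewrite nnegrE psum_ge0.
  by rewrite nnegrE alpha_ge0.
Qed.

(** Jensen in row i puts weight 1 - rho on |X_i| / (1 - rho) and |A_ij| on the gaps. Summing over i
    then needs column sums, which symmetry makes row sums. *)
Lemma field_gap_powR_le (r : R) x : 1 < r -> (forall i, \sum_j `|A i j| <= rho) ->
  \sum_i `|field_gap A u x i 0| `^ r <= \sum_i (`|X i x| / (1 - rho)) `^ r.
Proof.
move=> r1 rows; set W := \sum_i _; set Y := \sum_i _.
suff h : W <= (1 - rho) * Y + rho * W.
  by rewrite -(ler_pM2l q0) mulrBl mul1r lerBlDr.
apply: (@le_trans _ _ (\sum_i ((1 - rho) * (`|X i x| / (1 - rho)) `^ r +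
    \sum_j `|A i j| * `|field_gap A u x j 0| `^ r))).
  apply: ler_sum => i _; have y0 : 0 <= `|X i x| / (1 - rho) by rewrite divr_ge0// ltW.
  apply: (powR_jensen r1 (ltW rho_lt1) (normr_ge0 _) y0 _ _ (rows i)) => //.
  rewrite [(1 - rho) * _]mulrC divfK ?gt_eqF// (field_gapE mu A c).
  rewrite (le_trans (ler_normD _ _))// lerD2l mxE (le_trans (ler_norm_sum _ _ _))//.
  by apply: ler_sum => j _; rewrite normrM ler_wpM2l// (mean_gap_le qm opt).
rewrite big_split /= -mulr_sumr lerD2l exchange_big /= mulr_sumr; apply: ler_sum => j _.
rewrite -mulr_suml ler_wpM2r ?powR_ge0// (le_trans _ (rows j))//.
by apply: ler_sum => i _; rewrite -{1}AT mxE.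
Qed.

(** The right side is sqrt 2 times the left: with r = 2 x, the powers of 2 move into the base 2 e
    and into r. *)
Lemma powR_constant_le (B x : R) : 0 < B -> 0 < x ->
  B `^ x * (x `^ (x + 2^-1) * expR (- x)) <=
  (B / (2 * expR 1)) `^ x * (x *+ 2) `^ (x + 2^-1).
Proof.
move=> B0 x0; have e0 := expR_gt0 (1 : R).
have x2 : 0 < x *+ 2 by rewrite pmulrn_lgt0.
have Be : 0 < B / (2 * expR 1) by rewrite divr_gt0// mulr_gt0.
rewrite /powR !gt_eqF// -!expRD ler_expR.
have -> : ln (B / (2 * expR 1)) = ln B - ln 2 - 1.
  by rewrite ln_div ?posrE ?mulr_gt0// lnM ?posrE// expRK opprD addrA.
have -> : ln (x *+ 2) = ln 2 + ln x by rewrite -[x *+ 2]mulr_natl lnM ?posrE.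
have h12 : 1 <= 2 :> R by lra.
move: (ln_ge0 h12).
by move: (ln B) (ln 2) (ln x) => p q l q1; lra.
Qed.

(** Since |gamma|^2 <= alpha for a row gamma, dividing by alpha only weakens the Gaussian tail and
    gives 2 e^(-t) for Y. The r-th power of |X_i| / (1 - rho) is B^x Y^x with x = r / 2 >= 1. *)
Lemma innov_powR_moment (a r : R) i : concentration_constant rho a ->
  (forall v : 'cV[R]_n, psum 2 (A *m v) <= rho ^+ 2 * psum 2 v) ->
  0 < alpha A -> 2 <= r ->
  \int[P]_x (`|X i x| / (1 - rho)) `^ r <=
  2 * expR 4 * ((alpha A / (2 * a * expR 1 * (1 - rho) ^+ 2)) `^ (r / 2) *
    r `^ ((r + 1) / 2)).
Proof.
move=> [a0 conc] contr al0 r2.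
have bX := mbounded_innov qm (row_col A i).
have opA : opnorm (@lpnorm R 2 n) A <= rho by apply: opnorm_l2_le => //; exact: ltW.
have tailX t := conc n mu A c P qm opA _ (cmean_cond_expectation qm) (row_col A i) t.
pose k := a / alpha A; have k0 : 0 < k by rewrite divr_gt0.
pose Y x := k * X i x ^+ 2.
have bY : mbounded ncube Y by exact/mboundedZ/mboundedX.
have Y0 x : 0 <= Y x by rewrite mulr_ge0 ?sqr_ge0// ltW.
have tailY t : 0 < t -> (P [set x | (t < Y x)%R] <= (2 * expR (- t))%:E)%E.
  (* A zero row would put 0 in the denominator of the concentration bound; there Y vanishes
     identically. *)
  move=> t0; have [S0|Sn0] := eqVneq (psum 2 (row_col A i)) 0.
    have g0 j : row_col A i j 0 = 0.
      apply/eqP; rewrite -normr_eq0 -sqrf_eq0 eq_le exprn_ge0// andbT -S0.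
      exact: psum_coord.
    rewrite (_ : [set x | _] = set0) ?measure0 ?lee_fin ?mulr_ge0 ?expR_ge0//.
    apply/seteqP; split => x //=; rewrite /Y /innov big1 => [|j _]; last by rewrite g0 mul0r.
    by rewrite expr0n mulr0 ltNge ltW.
  have Sp : 0 < psum 2 (row_col A i) by rewrite lt_def Sn0 psum_ge0.
  pose t' := Num.sqrt (t / k); have t'0 : 0 < t' by rewrite sqrtr_gt0 divr_gt0.
  have t'2 : t' ^+ 2 = t / k by rewrite sqr_sqrtr// ltW// divr_gt0.
  rewrite (_ : [set x | _] = [set x | (t' < `|X i x|)%R]); last first.
    apply/seteqP; split => x /=.
      by rewrite /Y mulrC -ltr_pdivrMr// -t'2 -(real_normK (num_real (X i x)))
        ltr_pXn2r ?nnegrE// ltW.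
    by rewrite /Y [k * _]mulrC -ltr_pdivrMr// -t'2 -(real_normK (num_real (X i x)))
      ltr_pXn2r ?nnegrE// ltW.
  apply: le_trans (tailX t' t'0) _; rewrite lee_fin ler_pM2l// ler_expR lerN2.
  rewrite (@lpnorm_exp R 2)// t'2 ler_pdivlMr// (le_trans (ler_wpM2l (ltW t0)
    (psum_row_col A i)))//.
  by rewrite /k le_eqVlt; apply/orP; left; apply/eqP; field; rewrite !gt_eqF.
have [x xE] : exists x, r / 2 = x by exists (r / 2).
have x1 : 1 <= x by rewrite -xE ler_pdivlMr// mul1r.
have x0 : 0 < x by exact: lt_le_trans x1.
have rE : r = x *+ 2 by rewrite -xE -mulr_natr divfK.
pose B := alpha A / (a * (1 - rho) ^+ 2).
have B0 : 0 < B by rewrite divr_gt0// mulr_gt0// exprn_gt0.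
have E y : (`|X i y| / (1 - rho)) `^ r = B `^ x * Y y `^ x.
  have h0 : 0 <= `|X i y| / (1 - rho) by rewrite divr_ge0// ltW.
  rewrite -(powRM x (ltW B0) (Y0 y)) rE -[x *+ 2]mulr_natl powRrM powR_mulrn//; congr (_ `^ _).
  rewrite expr_div_n real_normK ?num_real// /Y /k /B.
  by field; rewrite !gt_eqF.
rewrite (_ : \int[P]_y _ = \int[P]_y (B `^ x * Y y `^ x));
  last by apply: eq_Rintegral => y _; rewrite E.
rewrite (mbounded_RintegralZl mQ PQ _ (mbounded_powR bY Y0 (ltW x0))).
apply: le_trans (ler_wpM2l (powR_ge0 _ _) (subexp_powR_moment mQ PQ bY Y0 tailY x1)) _.
rewrite mulrCA ler_wpM2l ?mulr_ge0 ?expR_ge0//.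
apply: le_trans (powR_constant_le B0 x0) _.
rewrite xE -rE (_ : (r + 1) / 2 = x + 2^-1); last by rewrite -xE mulrDl mul1r.
rewrite (_ : B / (2 * expR 1) = alpha A / (2 * a * expR 1 * (1 - rho) ^+ 2))//.
have e0 := expR_gt0 (1 : R).
by rewrite /B; field; rewrite !gt_eqF.
Qed.

Lemma gap_moment_powR (a r : R) : concentration_constant rho a ->
  (forall i, \sum_j `|A i j| <= rho) -> 2 <= r ->
  ('E_P[fun x => (\sum_(i < n) `|local_field A (spins x) i - local_field A u i| `^ r)%R] <=
   (2 * expR 4 * (n%:R * (alpha A / (2 * a * expR 1 * (1 - rho) ^+ 2)) `^ (r / 2) *
      r `^ ((r + 1) / 2)))%:E)%E.
Proof.
move=> conc rows r2; have r1 : 1 < r by rewrite (lt_le_trans _ r2)// ltr1n.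
have r0 : 0 <= r by rewrite ltW// (lt_trans _ r1).
have contr := l2_le_linf AT rho_gt0 rows.
rewrite -[n%:R * _ * _]mulrA mulrCA.
apply: (@expectation_gap_le (fun t => `|t| `^ r) (fun t => (`|t| / (1 - rho)) `^ r)).
- by move=> i; apply: mbounded_powR => //; exact/mbounded_norm/mbounded_field_gap.
- move=> i; apply: mbounded_powR => //.
    by apply: mboundedM; [exact: mbounded_norm (mbounded_innov qm _)|exact: mbounded_cst].
  by move=> x; rewrite divr_ge0// ltW.
- by move=> x; exact: field_gap_powR_le.
(* Y is normalised by 1 / alpha, so alpha = 0 stands apart: all rows vanish and with them the
   innovations. *)
move=> i; have [al0|al0] := eqVneq (alpha A) 0; last first.
  by apply: innov_powR_moment => //; rewrite lt_def al0 alpha_ge0.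
have g0 j : row_col A i j 0 = 0.
  apply/eqP; rewrite -normr_eq0 -sqrf_eq0 eq_le exprn_ge0// andbT -al0.
  exact: le_trans (psum_coord _ _ _) (psum_row_col A i).
rewrite (_ : \int[P]_x _ = \int[P]_x 0).
  by rewrite (Rintegral_cstT P) !mulr_ge0 ?expR_ge0 ?powR_ge0.
apply: eq_Rintegral => x _; rewrite /innov big1 => [|j _]; last by rewrite g0 mul0r.
by rewrite normr0 mul0r powR0// gt_eqF// (lt_trans _ r1).
Qed.

End conclusions.

Theorem lemma3p2 (R : realType) (rho : R) (rho_gt0 : 0 < rho)
    (rho_lt1 : rho < 1) :
  [/\ exists2 C : R, 0 < C &
        forall (n : nat) (mu : 'I_n -> probability R R) (A : 'M[R]_n)
          (c : 'cV[R]_n) (P : probability (n.-tuple R) R) (u : 'cV[R]_n),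
        quadratic_model mu A c P -> mean_field_optimizer mu A c u ->
        opnorm (@lpnorm R 2 n) A <= rho ->
        ('E_P[fun x => (\sum_(i < n)
            (local_field A (spins x) i - local_field A u i) ^+ 2)%R] <=
         (C * (n%:R * alpha A))%:E)%E,
      exists2 C : R, 0 < C &
        forall (n : nat) (mu : 'I_n -> probability R R) (A : 'M[R]_n)
          (c : 'cV[R]_n) (P : probability (n.-tuple R) R) (u : 'cV[R]_n),
        quadratic_model mu A c P -> mean_field_optimizer mu A c u ->
        opnorm (@lpnorm R 4 n) A <= rho ->
        ('E_P[fun x => (\sum_(i < n)
            (local_field A (spins x) i - local_field A u i) ^+ 4)%R] <=
         (C * (n%:R * alpha A ^+ 2))%:E)%E &
      exists2 C : R, 0 < C &
        forall (a : R), concentration_constant rho a ->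
        forall (n : nat) (mu : 'I_n -> probability R R) (A : 'M[R]_n)
          (c : 'cV[R]_n) (P : probability (n.-tuple R) R) (u : 'cV[R]_n),
        quadratic_model mu A c P -> mean_field_optimizer mu A c u ->
        opnorm (@linfnorm R n) A <= rho ->
        forall r : R, 2 <= r ->
        ('E_P[fun x => (\sum_(i < n)
            `|local_field A (spins x) i - local_field A u i| `^ r)%R] <=
         (C * (n%:R *
            (alpha A / (2 * a * expR 1 * (1 - rho) ^+ 2)) `^ (r / 2) *
            r `^ ((r + 1) / 2)))%:E)%E].
Proof.
have q0 : 0 < 1 - rho by rewrite subr_gt0.
split.
- exists (56 / (1 - rho) ^+ 2); first by rewrite divr_gt0// exprn_gt0.
  move=> n mu A c P u qm opt Ar; apply: (gap_moment2 qm opt rho_gt0 rho_lt1).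
  exact: (opnorm_lp (k := 2) isT (ltW rho_gt0) Ar).
- exists (148 ^+ 2 / (1 - rho) ^+ 4); first by rewrite divr_gt0 ?exprn_gt0.
  move=> n mu A c P u qm opt Ar.
  have contr4 := opnorm_lp (k := 4) isT (ltW rho_gt0) Ar.
  have AT : A^T = A by have [_ [-> _] _] := qm.
  exact: (gap_moment4 qm opt rho_gt0 rho_lt1 (l2_le_l4 AT rho_gt0 contr4) contr4).
- exists (2 * expR 4); first by rewrite mulr_gt0// expR_gt0.
  move=> a conc n mu A c P u qm opt Ar r r2.
  exact: (gap_moment_powR qm opt rho_gt0 rho_lt1 conc (opnorm_linf Ar) r2).
Qed.
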